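(* Let $G$ be a finite group and let $A$ be a finite $G$-set with $|A|=n$. There is an isomorphism of $G$-modules $$H^{n-3}(\mathbb T(A))\cong \varepsilon^G_A\otimes \mathrm{Lie}_A ,$$ where $\varepsilon^G_A$ is the sign representation of $G$ induced by the action on $A$, and $H^*$ denotes integral cohomology with the $G$-action induced by the action of $G$ on $\mathbb T(A)$.
   Context: $\mathrm{Lie}_A$: let $\mathcal L_A$ be the free Lie algebra over $\mathbb Z$ on the set $A$, with $G$-action induced from that on $A$; $\mathrm{Lie}_A\le\mathcal L_A$ is the subgroup (a $G$-submodule) generated by Lie monomials containing every generator $a\in A$ exactly once. $\varepsilon^G_A$ is the $\mathbb Z$-module $\mathbb Z$ on which $g\in G$ acts by $\det(g)=\pm1$, the determinant of $g$ acting on the free abelian group on $A$ (the sign of the permutation of $A$ given by $g$). Tensor product is over $\mathbb Z$ with diagonal action. Trees. A tree is a finite tree whose internal (inner) edges are attached to a vertex at both ends, and whose external edges are attached to only one vertex; one external edge is the root, the others are the leaves, and the tree is oriented from the leaves down to the root. No vertex is nullary. An $A$-tree is a tree with a (non-equivariant) labeling bijection $f$ from $A$ to its set of leaves. It is reduced if no vertex is unary (exactly one incoming edge), and measured if each inner edge is assigned a length in $(0,1]$, with at least one inner edge of length $1$. Isomorphisms are root-, label- and length-preserving homeomorphisms. $\mathbb T(A)$ is the $G$-space of isomorphism classes of reduced measured $A$-trees, topologized as a simplicial complex: vertices are the measured trees with exactly one inner edge; each isomorphism class $S$ of reduced $A$-trees with $k+1\ge 1$ inner edges gives a $k$-simplex,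 whose vertices are obtained by collapsing all but one inner edge and giving it length $1$; a measured tree of shape $S$ is the point whose barycentric coordinate at the inner edge $e$ is the length of $e$ divided by the sum of the lengths of all inner edges. $g\in G$ acts by $(T,f)\mapsto(T,fg^{-1})$.
   Formalization: H^* is taken as reduced cohomology, since for n=3 the space is three points (H^0=Z^3, but Lie_A has rank 2) and for n=2 it is empty; n=1 is excluded, since there H^{-2}=0 but Lie_A=Z. For n≥4 nothing changes. *)

(* Defs.v *)
From HB Require Import structures.
From mathcomp Require Import all_boot all_order all_fingroup all_algebra.
From mathcomp Require Import finmap generic_quotient ring_quotient.
From mathcomp Require Import mathcomp_extra boolp functions.
From mathcomp Require Import freeg.

Set Implicit Arguments.
Unset Strict Implicit.
Unset Printing Implicit Defensive.

Import GRing.Theory.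
Local Open Scope ring_scope.
Local Open Scope quotient_scope.

(* Left actions, unlike MathComp's {action gT &-> X}, which acts on the right *)
Record lact (gT : finGroupType) (X : Type) := Lact {
  lop :> gT -> X -> X;
  lop1 : forall x, lop 1%g x = x;
  lopM : forall g h x, lop (g * h)%g x = lop g (lop h x)
}.

Lemma lopK (gT : finGroupType) X (to : lact gT X) g : cancel (to g) (to g^-1%g).
Proof. by move=> x; rewrite -lopM mulVg lop1. Qed.

Lemma lopVK (gT : finGroupType) X (to : lact gT X) g : cancel (to g^-1%g) (to g).
Proof. by move=> x; rewrite -lopM mulgV lop1. Qed.

Lemma lop_bij (gT : finGroupType) X (to : lact gT X) g : bijective (to g).
Proof. exact: Bijective (lopK to g) (lopVK to g). Qed.

Record gmodule (gT : finGroupType) := GModule {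
  gcar :> zmodType;
  gact : lact gT gcar;
  gactB : forall g, zmod_morphism (gact g)
}.

Lemma gactD (gT : finGroupType) (M : gmodule gT) g (x y : M) :
  gact M g (x + y) = gact M g x + gact M g y.
Proof.
have gN z : gact M g (- z) = - gact M g z.
  by rewrite -[- z]sub0r gactB -[X in gact M g X](subrr z) gactB subrr sub0r.
by rewrite -{1}[y]opprK gactB gN opprK.
Qed.

Definition gmod_iso (gT : finGroupType) (M N : gmodule gT) : Prop :=
  exists f : M -> N, [/\ zmod_morphism f, bijective f &
    forall g x, f (gact M g x) = gact N g (f x)].

Record subz (M : zmodType) (S : zmodClosed M) :=
  Subz { subz_val :> M; _ : subz_val \in S }.

HB.instance Definition _ M S := [isSub for @subz_val M S].
HB.instance Definition _ M S := [Choice of @subz M S by <:].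
HB.instance Definition _ M S := [SubChoice_isSubZmodule of @subz M S by <:].

Section GModuleConstructions.
Variables (gT : finGroupType) (M : gmodule gT) (S : zmodClosed M).
Hypothesis stabS : forall g x, x \in S -> gact M g x \in S.

Definition sub_op g (x : subz S) : subz S := Subz (stabS g (valP x)).

Lemma sub_op1 x : sub_op 1%g x = x.
Proof. by apply: val_inj; rewrite /= lop1. Qed.

Lemma sub_opM g h x : sub_op (g * h)%g x = sub_op g (sub_op h x).
Proof. by apply: val_inj; rewrite /= lopM. Qed.

Lemma sub_opB g : zmod_morphism (sub_op g).
Proof. by move=> x y; apply: val_inj; rewrite /= gactB. Qed.

Definition sub_gmodule : gmodule gT := GModule (gact := Lact sub_op1 sub_opM) sub_opB.

Definition quot_op g (x : Quotient.quot S) : Quotient.quot S :=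
  \pi_(Quotient.quot S) (gact M g (repr x)).

Lemma quot_opE g x :
  quot_op g (\pi_(Quotient.quot S) x) = \pi_(Quotient.quot S) (gact M g x).
Proof.
rewrite /quot_op; apply/eqP; rewrite -Quotient.idealrBE -gactB stabS //.
by rewrite Quotient.idealrBE reprK.
Qed.

Lemma quot_op1 x : quot_op 1%g x = x.
Proof. by elim/quotW: x => x; rewrite quot_opE lop1. Qed.

Lemma quot_opM g h x : quot_op (g * h)%g x = quot_op g (quot_op h x).
Proof. by elim/quotW: x => x; rewrite quot_opE (quot_opE h) quot_opE lopM. Qed.

Lemma quot_opB g : zmod_morphism (quot_op g).
Proof.
have piB : zmod_morphism \pi_(Quotient.quot S) by move=> x y; rewrite !piE.
move=> x y; rewrite -[x]reprK -[y]reprK.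
by rewrite -piB !quot_opE gactB piB.
Qed.

Definition quot_gmodule : gmodule gT :=
  GModule (gact := Lact quot_op1 quot_opM) quot_opB.

End GModuleConstructions.

Inductive span_prop (M : zmodType) (X : M -> Prop) : M -> Prop :=
| span0 : span_prop X 0
| span_gen x : X x -> span_prop X x
| spanB x y : span_prop X x -> span_prop X y -> span_prop X (x - y).

Definition span (M : zmodType) (X : M -> Prop) : pred M := fun x => `[< span_prop X x >].

Lemma span_zmod_closed M X : zmod_closed (@span M X).
Proof.
split; first exact/asboolP/span0.
by move=> x y /asboolP Xx /asboolP Xy; apply/asboolP; apply: spanB.
Qed.

HB.instance Definition _ M X := GRing.isZmodClosed.Build M (@span M X) (span_zmod_closed X).

Lemma span_stable (gT : finGroupType) (M : gmodule gT) (X : M -> Prop) :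
  (forall g x, X x -> X (gact M g x)) ->
  forall g x, x \in span X -> gact M g x \in span X.
Proof.
move=> stabX g x /asboolP Xx; apply/asboolP; elim: Xx => [|y Xy|y z _ IHy _ IHz].
- by rewrite -(subrr 0) gactB subrr; exact: span0.
- exact/span_gen/stabX.
- by rewrite gactB; exact: spanB.
Qed.

Section Tensor.
Variables (gT : finGroupType) (M N : gmodule gT).
Local Notation F := {freeg (M * N)%type / int}.

Definition ten_op g : F -> F :=
  fglift (fun mn => << (gact M g mn.1, gact N g mn.2) >>).

Lemma ten_opB g : zmod_morphism (ten_op g).
Proof. exact: lift_is_additive. Qed.

HB.instance Definition _ g := GRing.isZmodMorphism.Build F F (ten_op g) (ten_opB g).

Lemma ten_opU g k m n :
  ten_op g << k *g (m, n) >> = << k *g (gact M g m, gact N g n) >>.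
Proof.
rewrite /ten_op liftU; apply/eqP/freeg_eqP => z.
by rewrite coeffZ !coeffU mul1r.
Qed.

Lemma ten_op1 x : ten_op 1%g x = x.
Proof.
rewrite -[x in LHS]freeg_sumE raddf_sum -[RHS]freeg_sumE.
by apply: eq_bigr => -[m n] _; rewrite /= ten_opU !lop1.
Qed.

Lemma ten_opM g h x : ten_op (g * h)%g x = ten_op g (ten_op h x).
Proof.
rewrite -[x]freeg_sumE !raddf_sum.
by apply: eq_bigr => -[m n] _; rewrite /= !ten_opU !lopM.
Qed.

Definition free_pairs : gmodule gT := GModule (gact := Lact ten_op1 ten_opM) ten_opB.

Inductive bilin_rel : free_pairs -> Prop :=
| bilin_l m m' n :
    bilin_rel (<< (m + m', n) >> - << (m, n) >> - << (m', n) >> : F)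
| bilin_r m n n' :
    bilin_rel (<< (m, n + n') >> - << (m, n) >> - << (m, n') >> : F).

Lemma bilin_rel_stable g x : bilin_rel x -> bilin_rel (gact free_pairs g x).
Proof.
case=> [m m' n|m n n']; rewrite !gactB /= !ten_opU gactD.
  exact: (bilin_l (gact M g m) (gact M g m') (gact N g n)).
exact: (bilin_r (gact M g m) (gact N g n) (gact N g n')).
Qed.

Definition tensor : gmodule gT := quot_gmodule (span_stable bilin_rel_stable).

End Tensor.

Section Sign.
Variables (gT : finGroupType) (A : finType) (to : lact gT A).

Definition act_mx (g : gT) : 'M[int]_#|A| :=
  \matrix_(i, j) (enum_val i == to g (enum_val j))%:R.

Lemma act_mx1 : act_mx 1%g = 1%:M.
Proof.
by apply/matrixP=> i j; rewrite !mxE lop1 (inj_eq enum_val_inj).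
Qed.

Lemma act_mxM g h : act_mx (g * h)%g = act_mx g *m act_mx h.
Proof.
apply/matrixP=> i j; rewrite !mxE (bigD1 (enum_rank (to h (enum_val j)))) //=.
rewrite !mxE !enum_rankK eqxx mulr1 lopM big1 ?addr0 // => k ne_k.
rewrite !mxE [_ == to h _](introF eqP) ?mulr0 // => def_k.
by rewrite -def_k enum_valK eqxx in ne_k.
Qed.

Definition eps_op g (x : int) : int := \det (act_mx g) * x.

Lemma eps_op1 x : eps_op 1%g x = x.
Proof. by rewrite /eps_op act_mx1 det1 mul1r. Qed.

Lemma eps_opM g h x : eps_op (g * h)%g x = eps_op g (eps_op h x).
Proof. by rewrite /eps_op act_mxM det_mulmx mulrA. Qed.

Lemma eps_opB g : zmod_morphism (eps_op g).
Proof. by move=> x y; exact: mulrBr. Qed.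

Definition epsilon : gmodule gT := GModule (gact := Lact eps_op1 eps_opM) eps_opB.

End Sign.

Inductive lterm (A : Type) : Type :=
| Lgen of A | Lzero | Ladd of lterm A & lterm A | Lopp of lterm A
| Lbrk of lterm A & lterm A.
Arguments Lzero {A}.

HB.instance Definition _ A := gen_eqMixin (lterm A).
HB.instance Definition _ A := gen_choiceMixin (lterm A).

(* The least congruence forcing the axioms of Lie algebras over the integers;
   compatibility with integer scalars follows from biadditivity *)
Inductive lie_eq (A : Type) : lterm A -> lterm A -> Prop :=
| lie_refl x : lie_eq x x
| lie_sym x y : lie_eq x y -> lie_eq y x
| lie_trans x y z : lie_eq x y -> lie_eq y z -> lie_eq x z
| lie_add x x' y y' : lie_eq x x' -> lie_eq y y' -> lie_eq (Ladd x y) (Ladd x' y')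
| lie_opp x x' : lie_eq x x' -> lie_eq (Lopp x) (Lopp x')
| lie_brk x x' y y' : lie_eq x x' -> lie_eq y y' -> lie_eq (Lbrk x y) (Lbrk x' y')
| lie_addA x y z : lie_eq (Ladd x (Ladd y z)) (Ladd (Ladd x y) z)
| lie_addC x y : lie_eq (Ladd x y) (Ladd y x)
| lie_add0 x : lie_eq (Ladd Lzero x) x
| lie_addN x : lie_eq (Ladd (Lopp x) x) Lzero
| lie_brkDl x y z : lie_eq (Lbrk (Ladd x y) z) (Ladd (Lbrk x z) (Lbrk y z))
| lie_brkDr x y z : lie_eq (Lbrk x (Ladd y z)) (Ladd (Lbrk x y) (Lbrk x z))
| lie_alt x : lie_eq (Lbrk x x) Lzero
| lie_jacobi x y z :
    lie_eq (Ladd (Lbrk x (Lbrk y z)) (Ladd (Lbrk y (Lbrk z x)) (Lbrk z (Lbrk x y)))) Lzero.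

Section FreeLie.
Variable A : Type.

Definition lie_eqb (x y : lterm A) := `[< lie_eq x y >].

Lemma lie_eqb_equiv : equiv_class_of lie_eqb.
Proof.
split=> [x|x y|y x z]; first exact/asboolP/lie_refl.
- by apply/asboolP/asboolP => /lie_sym.
- by move=> /asboolP xy /asboolP yz; apply/asboolP; exact: lie_trans xy yz.
Qed.

Canonical lie_eqb_equivRel := EquivRelPack lie_eqb_equiv.
Canonical lie_eqb_encModRel := defaultEncModRel lie_eqb.

Definition free_lie := {eq_quot lie_eqb}.
HB.instance Definition _ : EqQuotient _ lie_eqb free_lie := EqQuotient.on free_lie.
HB.instance Definition _ := Choice.on free_lie.

Lemma lie_piP x y : lie_eq x y <-> \pi_free_lie x = \pi_free_lie y.
Proof. by split=> [xy|/eqmodP/asboolP //]; apply/eqmodP/asboolP. Qed.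

Lemma lie_reprP x : lie_eq (repr (\pi_free_lie x)) x.
Proof. by apply/lie_piP; rewrite reprK. Qed.

Definition flie_zero : free_lie := \pi_free_lie Lzero.
Definition flie_add (x y : free_lie) : free_lie := \pi_free_lie (Ladd (repr x) (repr y)).
Definition flie_opp (x : free_lie) : free_lie := \pi_free_lie (Lopp (repr x)).
Definition flie_brk (x y : free_lie) : free_lie := \pi_free_lie (Lbrk (repr x) (repr y)).

Lemma flie_addE x y : flie_add (\pi_free_lie x) (\pi_free_lie y) = \pi_free_lie (Ladd x y).
Proof. by apply/lie_piP/lie_add; exact: lie_reprP. Qed.

Lemma flie_oppE x : flie_opp (\pi_free_lie x) = \pi_free_lie (Lopp x).
Proof. by apply/lie_piP/lie_opp; exact: lie_reprP. Qed.

Lemma flie_brkE x y : flie_brk (\pi_free_lie x) (\pi_free_lie y) = \pi_free_lie (Lbrk x y).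
Proof. by apply/lie_piP/lie_brk; exact: lie_reprP. Qed.

Lemma flie_addA : associative flie_add.
Proof.
elim/quotW=> x; elim/quotW=> y; elim/quotW=> z.
rewrite (flie_addE y) (flie_addE x y) !flie_addE; exact/lie_piP/lie_addA.
Qed.

Lemma flie_addC : commutative flie_add.
Proof.
elim/quotW=> x; elim/quotW=> y; rewrite !flie_addE; exact/lie_piP/lie_addC.
Qed.

Lemma flie_add0 : left_id flie_zero flie_add.
Proof. elim/quotW=> x; rewrite flie_addE; exact/lie_piP/lie_add0. Qed.

Lemma flie_addN : left_inverse flie_zero flie_opp flie_add.
Proof. elim/quotW=> x; rewrite flie_oppE flie_addE; exact/lie_piP/lie_addN. Qed.

HB.instance Definition _ :=
  GRing.isZmodule.Build free_lie flie_addA flie_addC flie_add0 flie_addN.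

End FreeLie.

Inductive lie_monomial (A : Type) := Mgen of A | Mbrk of lie_monomial A & lie_monomial A.

Fixpoint mon_gens (A : Type) (m : lie_monomial A) : seq A :=
  match m with Mgen a => [:: a] | Mbrk p q => mon_gens p ++ mon_gens q end.

Fixpoint mon_val (A : Type) (m : lie_monomial A) : free_lie A :=
  match m with Mgen a => \pi_(free_lie A) (Lgen a) | Mbrk p q => flie_brk (mon_val p) (mon_val q) end.

Fixpoint lmap (A B : Type) (f : A -> B) (x : lterm A) : lterm B :=
  match x with
  | Lgen a => Lgen (f a)
  | Lzero => Lzero
  | Ladd x y => Ladd (lmap f x) (lmap f y)
  | Lopp x => Lopp (lmap f x)
  | Lbrk x y => Lbrk (lmap f x) (lmap f y)
  end.

Fixpoint mon_map (A B : Type) (f : A -> B) (m : lie_monomial A) : lie_monomial B :=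
  match m with Mgen a => Mgen (f a) | Mbrk p q => Mbrk (mon_map f p) (mon_map f q) end.

Lemma lmap_eq A B (f : A -> B) x y : lie_eq x y -> lie_eq (lmap f x) (lmap f y).
Proof.
elim=> {x y} /=.
- by move=> *; exact: lie_refl.
- by move=> *; exact: lie_sym.
- by move=> x y z _ xy _ yz; exact: lie_trans xy yz.
- by move=> *; exact: lie_add.
- by move=> *; exact: lie_opp.
- by move=> *; exact: lie_brk.
- by move=> *; exact: lie_addA.
- by move=> *; exact: lie_addC.
- by move=> *; exact: lie_add0.
- by move=> *; exact: lie_addN.
- by move=> *; exact: lie_brkDl.
- by move=> *; exact: lie_brkDr.
- by move=> *; exact: lie_alt.
- by move=> *; exact: lie_jacobi.
Qed.

Lemma lmap_id A (f : A -> A) : f =1 id -> lmap f =1 id.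
Proof. by move=> f_id; elim=> //= [a|x -> y ->|x ->|x -> y ->] //; rewrite f_id. Qed.

Lemma lmap_comp A B C (f : B -> C) (g : A -> B) x : lmap f (lmap g x) = lmap (f \o g) x.
Proof. by elim: x => //= [x -> y ->|x ->|x -> y ->]. Qed.

Section LieModule.
Variables (gT : finGroupType) (A : finType) (to : lact gT A).

Definition flie_op g (x : free_lie A) : free_lie A :=
  \pi_(free_lie A) (lmap (to g) (repr x)).

Lemma flie_opE g x :
  flie_op g (\pi_(free_lie A) x) = \pi_(free_lie A) (lmap (to g) x).
Proof. exact/lie_piP/lmap_eq/lie_reprP. Qed.

Lemma flie_op1 x : flie_op 1%g x = x.
Proof. by rewrite -[x]reprK flie_opE lmap_id // => a; rewrite lop1. Qed.

Lemma flie_opM g h x : flie_op (g * h)%g x = flie_op g (flie_op h x).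
Proof.
rewrite -[x]reprK flie_opE (flie_opE h) flie_opE lmap_comp.
by congr (\pi_(free_lie A) (lmap _ _)); apply/funext => a; rewrite lopM.
Qed.

Lemma flie_opB g : zmod_morphism (flie_op g).
Proof.
move=> x y; rewrite -[x]reprK -[y]reprK.
by rewrite -[_ - _]/(flie_add _ (flie_opp _)) flie_oppE flie_addE !flie_opE
  -[RHS]/(flie_add _ (flie_opp _)) flie_oppE flie_addE.
Qed.

Definition free_lie_gmodule : gmodule gT :=
  GModule (gact := Lact flie_op1 flie_opM) flie_opB.

Lemma flie_op_brk g x y : flie_op g (flie_brk x y) = flie_brk (flie_op g x) (flie_op g y).
Proof.
by rewrite -[x]reprK -[y]reprK flie_brkE !flie_opE flie_brkE.
Qed.

Definition multilinear (x : free_lie_gmodule) : Prop :=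
  exists2 m : lie_monomial A,
    forall a, count_mem a (mon_gens m) = 1%N & x = mon_val m.

Lemma multilinear_stable g x : multilinear x -> multilinear (gact free_lie_gmodule g x).
Proof.
case=> m m1 ->; exists (mon_map (to g) m) => [a|].
  have -> : mon_gens (mon_map (to g) m) = map (to g) (mon_gens m).
    by elim: {m1}m => //= p -> q ->; rewrite map_cat.
  rewrite count_map -[RHS](m1 (to g^-1%g a)); apply: eq_count => b /=.
  exact: can2_eq (lopK to g) (lopVK to g) b a.
elim: {m1}m => [a|p IHp q IHq] /=; first exact: flie_opE.
by rewrite flie_op_brk; congr flie_brk.
Qed.

Definition Lie : gmodule gT := sub_gmodule (span_stable multilinear_stable).

End LieModule.

Record gcomplex (gT : finGroupType) := GComplex {
  vertex : choiceType;
  vact : lact gT vertex;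
  simplex : {fset vertex} -> Prop;
  simplex_neq0 : forall s, simplex s -> s != fset0;
  simplex_sub : forall s t, simplex s -> (t `<=` s)%fset -> t != fset0 -> simplex t;
  simplexG : forall g s, simplex s -> simplex [fset vact g x | x in s]%fset
}.

Section Cohomology.
Variables (gT : finGroupType) (K : gcomplex gT).
Local Notation V := (vertex K).

(* The empty list is an ordered simplex of dimension -1, whence reduced cohomology *)
Definition ordered_simplex (s : seq V) : Prop :=
  uniq s /\ (s = [::] \/ simplex [fset x in s]%fset).

(* Alternating functions on ordered d-simplices, extended by 0 to all lists *)
Definition cochain (d : int) (phi : seq V -> int) : Prop :=
  (forall s, phi s != 0 -> ordered_simplex s /\ (size s)%:Z = d + 1) /\
  (forall m (t : m.-tuple V) (p : 'S_m),
     phi [tuple tnth t (p i) | i < m] = (-1) ^+ p * phi t).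

Definition delta (phi : seq V -> int) (s : seq V) : int :=
  if `[< ordered_simplex s >]
  then \sum_(i < size s) (-1) ^+ i * phi (take i s ++ drop i.+1 s) else 0.

Lemma deltaB phi psi : delta (phi - psi) = delta phi - delta psi.
Proof.
apply/funext => s; rewrite -[RHS]/(delta phi s - delta psi s) /delta.
case: ifP => _; last by rewrite subrr.
by rewrite -sumrB; apply: eq_bigr => i _; rewrite -mulrBr.
Qed.

Lemma cochainB d phi psi : cochain d phi -> cochain d psi -> cochain d (phi - psi).
Proof.
move=> [phi0 phiP] [psi0 psiP]; split=> [s|m t p].
  have [phis0|/phi0 //] := eqVneq (phi s) 0.
  have [psis0|/psi0 //] := eqVneq (psi s) 0.
  by rewrite -[(phi - psi) s]/(phi s - psi s) phis0 psis0 subrr eqxx.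
by rewrite -[LHS]/(phi _ - psi _) phiP psiP -mulrBr.
Qed.

Lemma cochain0 d : cochain d 0.
Proof. by split=> [s /eqP[]|m t p] //; rewrite -[RHS]/(_ * 0) mulr0. Qed.

Lemma delta0 : delta 0 = 0.
Proof. by rewrite -[X in delta X](subrr 0) deltaB subrr. Qed.

Definition cf_op (g : gT) (phi : seq V -> int) : seq V -> int :=
  fun s => phi (map (vact K g^-1%g) s).

Lemma cf_op1 phi : cf_op 1%g phi = phi.
Proof.
apply/funext => s; rewrite /cf_op invg1 map_id_in // => x _; exact: lop1.
Qed.

Lemma cf_opM g h phi : cf_op (g * h)%g phi = cf_op g (cf_op h phi).
Proof.
apply/funext => s; rewrite /cf_op -map_comp invMg.
by congr (phi _); apply: eq_map => x; exact: lopM.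
Qed.

Lemma cf_opB g : zmod_morphism (cf_op g).
Proof. by []. Qed.

Definition cf_gmodule : gmodule gT := GModule (gact := Lact cf_op1 cf_opM) cf_opB.

Lemma ordered_simplexG g s : ordered_simplex s -> ordered_simplex (map (vact K g) s).
Proof.
case=> Us s_simp; split.
  by rewrite map_inj_uniq //; exact: can_inj (lopK _ g).
case: s_simp => [->|/(simplexG g) s_simp]; [by left | right].
congr simplex: s_simp; apply/fsetP => x; rewrite !inE.
apply/imfsetP/mapP => /= -[y]; rewrite ?inE => ys ->; exists y => //.
by rewrite inE.
Qed.

Lemma cochainG g d phi : cochain d phi -> cochain d (cf_op g phi).
Proof.
case=> phi0 phiP; split=> [s /phi0|m t p].
  rewrite size_map => -[/(ordered_simplexG g)]; rewrite -map_comp.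
  by rewrite map_id_in // => x _; exact: lopVK.
rewrite /cf_op -(phiP _ (map_tuple (vact K g^-1%g) t)); congr (phi _).
by rewrite -[LHS]map_comp; apply: eq_map => i /=; rewrite tnth_map.
Qed.

Lemma deltaG g phi : delta (cf_op g phi) = cf_op g (delta phi).
Proof.
apply/funext => s; rewrite /cf_op /delta size_map.
have -> : `[< ordered_simplex (map (vact K g^-1%g) s) >] = `[< ordered_simplex s >].
  apply: asbool_equiv_eq; split=> [|/(ordered_simplexG g^-1%g)//].
  move=> /(ordered_simplexG g); rewrite -map_comp.
  by rewrite map_id_in // => x _; exact: lopVK.
by case: ifP => // _; apply: eq_bigr => i _; rewrite map_cat map_take map_drop.
Qed.

Definition cocycle d : pred cf_gmodule :=
  fun phi => `[< cochain d phi /\ delta phi = 0 >].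

Lemma cocycle_zmod_closed d : zmod_closed (cocycle d).
Proof.
split=> [|x y /asboolP[cx dx] /asboolP[cy dy]]; apply/asboolP.
  by split; [exact: cochain0 | exact: delta0].
by split; [exact: cochainB | rewrite deltaB dx dy subrr].
Qed.

HB.instance Definition _ d :=
  GRing.isZmodClosed.Build cf_gmodule (cocycle d) (cocycle_zmod_closed d).

Lemma cocycle_stable d g phi : phi \in cocycle d -> gact cf_gmodule g phi \in cocycle d.
Proof.
move=> /asboolP[cphi dphi]; apply/asboolP; split; first exact: cochainG.
by rewrite /= deltaG dphi.
Qed.

Definition cocycles d : gmodule gT := sub_gmodule (@cocycle_stable d).

Definition coboundary d : pred (cocycles d) :=
  fun z => `[< exists2 psi, cochain (d - 1) psi & subz_val z = delta psi >].

Lemma coboundary_zmod_closed d : zmod_closed (@coboundary d).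
Proof.
split=> [|x y /asboolP[p cp dp] /asboolP[q cq dq]]; apply/asboolP.
  by exists 0; [exact: cochain0 | rewrite delta0].
by exists (p - q); [exact: cochainB | rewrite deltaB -dp -dq].
Qed.

HB.instance Definition _ d :=
  GRing.isZmodClosed.Build (cocycles d) (@coboundary d) (coboundary_zmod_closed d).

Lemma coboundary_stable d g z :
  z \in @coboundary d -> gact (cocycles d) g z \in @coboundary d.
Proof.
move=> /asboolP[p cp dp]; apply/asboolP.
by exists (cf_op g p); [exact: cochainG | rewrite deltaG -dp].
Qed.

Definition reduced_cohomology d : gmodule gT := quot_gmodule (@coboundary_stable d).

End Cohomology.


(* Number of edges coming into v, where out w is the vertex at the lower end of
   the edge leaving w, and att l the vertex to which the leaf l is attached *)
Definition arity (V L : finType) (out : V -> option V) (att : L -> V) (v : V) : nat :=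
  (#|[pred l | att l == v]| + #|[pred w | out w == Some v]|)%N.

(* The edges are the leaves and, for each vertex v, the edge leaving v: it is
   the root edge if out v = None, and otherwise an inner edge, referred to as v
   below. External edges being attached to a vertex, a tree has at least one. *)
Record tree := Tree {
  nvert : nat;
  nleaf : nat;
  out : 'I_nvert -> option 'I_nvert;
  att : 'I_nleaf -> 'I_nvert;
  root : 'I_nvert;
  out_root : out root = None;
  rooted : forall v, connect [rel v w | out v == Some w] v root;
  no_nullary : forall v, arity out att v != 0%N
}.

Definition reduced (T : tree) : Prop := forall v, arity (@out T) (@att T) v != 1%N.

Definition inner (T : tree) : {set 'I_(nvert T)} := [set v | out v != None].

Lemma arityE (V L : finType) (out : V -> option V) (att : L -> V) v :
  arity out att v = (\sum_l (att l == v) + \sum_w (out w == Some v))%N.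
Proof.
by rewrite /arity -!sum1_card; congr addn; rewrite big_mkcond; apply: eq_bigr => i _;
  rewrite inE; case: eqP.
Qed.

Lemma arity_collapse (V W L : finType) (E : {set V}) (c : V -> W)
    (out : V -> option V) (att : L -> V) (out' : W -> option W) (att' : L -> W) :
  {in ~: E &, injective c} -> (forall y, exists2 v, v \in ~: E & c v = y) ->
  (forall v, v \in E -> omap c (out v) = Some (c v)) ->
  (forall v, v \in ~: E -> out' (c v) = omap c (out v)) ->
  (forall l, att' l = c (att l)) ->
  forall y, (arity out' att' y + \sum_u (c u == y) =
             (\sum_(u | c u == y) arity out att u).+1)%N.
Proof.
move=> c_inj c_surj cE cN catt y.
have [k kN ck] : exists2 k : W -> V, (forall z, k z \in ~: E) & cancel k c.
  have /choice[k kP] : forall z, exists v, v \in ~: E /\ c v = z.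
    by move=> z; have [v vN cv] := c_surj z; exists v.
  by exists k => z; have [] := kP z.
have sumN (f : W -> nat) : (\sum_(v in ~: E) f (c v) = \sum_z f z)%N.
  rewrite [RHS](reindex_onto c k) => [|z _]; last exact: ck.
  apply: eq_bigl => v /=; apply/idP/eqP => [vN|<-]; last exact: kN.
  by apply: c_inj; rewrite ?kN ?ck.
have sumE (f : V -> nat) : (\sum_v f v = \sum_(v in E) f v + \sum_(v in ~: E) f v)%N.
  rewrite (bigID (mem E)) /=; congr addn.
  by apply: eq_bigl => v; rewrite inE.
have sum_eq (x : V) : (\sum_(u | c u == y) (x == u) = (c x == y))%N.
  rewrite big_mkcond (bigD1 x) //= eqxx big1 ?addn0; first by case: (c x == y).
  by move=> u /negPf; rewrite eq_sym => ->; case: ifP.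
rewrite (eq_bigr _ (fun u _ => arityE out att u)) arityE.
rewrite big_split /= exchange_big /= (eq_bigr _ (fun l _ => sum_eq (att l))).
rewrite -(eq_bigr _ (fun l _ => congr1 (fun z => (z == y) : nat) (catt l))) -!addnA -addnS.
congr addn; rewrite exchange_big /=.
have sum_out w : (\sum_(u | c u == y) (out w == Some u) = (omap c (out w) == Some y))%N.
  by case: (out w) => [x|]; [exact: sum_eq | exact: big1].
rewrite (eq_bigr _ (fun w _ => sum_out w)) (sumE (fun u => (c u == y) : nat)).
rewrite (sumN (fun z => (z == y) : nat)) (sumE (fun w => (omap c (out w) == Some y) : nat)).
rewrite (eq_bigr _ (fun v vE => congr1 (fun z => (z == Some y) : nat) (cE v vE))).
rewrite -(eq_bigr _ (fun v vN => congr1 (fun z => (z == Some y) : nat) (cN v vN))).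
have -> : (\sum_z (z == y) = 1)%N.
  by rewrite (bigD1 y) //= eqxx big1 // => z /negPf->.
by rewrite -(sumN (fun z => (out' z == Some y) : nat)) addnCA addnA addn1.
Qed.

Lemma arity_collapse_ge (V W L : finType) (E : {set V}) (c : V -> W)
    (out : V -> option V) (att : L -> V) (out' : W -> option W) (att' : L -> W) (m : nat) :
  {in ~: E &, injective c} -> (forall y, exists2 v, v \in ~: E & c v = y) ->
  (forall v, v \in E -> omap c (out v) = Some (c v)) ->
  (forall v, v \in ~: E -> out' (c v) = omap c (out v)) ->
  (forall l, att' l = c (att l)) ->
  (forall v, m < arity out att v)%N -> forall y, (m < arity out' att' y)%N.
Proof.
move=> c_inj c_surj cE cN catt m_lt y.
have [v _ cv] := c_surj y.
have := arity_collapse c_inj c_surj cE cN catt y.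
have -> : (\sum_u (c u == y) = \sum_(u | c u == y) 1)%N.
  by rewrite [RHS]big_mkcond; apply: eq_bigr => u _; case: eqP.
rewrite (bigD1 v) ?cv //= [in RHS](bigD1 v) ?cv //= => def_y.
have : (\sum_(u | (c u == y) && (u != v)) 1 <=
        \sum_(u | (c u == y) && (u != v)) arity out att u)%N.
  by apply: leq_sum => u _; exact: leq_ltn_trans (m_lt u).
have := m_lt v; move: def_y.
set a := arity _ _ y; set b := arity _ _ v; set s := bigop _ _ _; set t := bigop _ _ _.
by move=> def_y mb st; rewrite -(ltn_add2r (1 + s)) def_y -addSn -addnS leq_add // add1n.
Qed.

Lemma down_ind (T : tree) (P : 'I_(nvert T) -> Prop) :
  (forall v, (forall w, out v = Some w -> P w) -> P v) -> forall v, P v.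
Proof.
move=> IH v; have /connectP[p pth] := rooted v.
elim: p v pth => [|w p IHp] v /=.
  by move=> _ def_v; apply: IH => w; rewrite -def_v out_root.
case/andP=> /eqP def_w pth def_r; apply: IH => u; rewrite def_w => -[<-].
exact: IHp.
Qed.

Inductive lands (T : tree) (E : {set 'I_(nvert T)}) : 'I_(nvert T) -> 'I_(nvert T) -> Prop :=
| lands0 v : v \in ~: E -> lands E v v
| landsS v u w : v \in E -> out v = Some u -> lands E u w -> lands E v w.

Lemma lands_exists (T : tree) (E : {set 'I_(nvert T)}) :
  E \subset inner T ->
  exists r : 'I_(nvert T) -> 'I_(nvert T),
    [/\ forall v, r v \in ~: E, forall v, v \in ~: E -> r v = v &
        forall v u, v \in E -> out v = Some u -> r v = r u].
Proof.
move=> /subsetP Ein.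
have lands_total v : exists w, lands E v w.
  elim/down_ind: v => v IH; have [vE|vN] := boolP (v \in E); last first.
    by exists v; apply: lands0; rewrite inE.
  have := Ein v vE; rewrite inE; case def_u: (out v) => [u|] // _.
  by have [w uw] := IH u def_u; exists w; exact: landsS uw.
have lands_fun v w w' : lands E v w -> lands E v w' -> w = w'.
  move=> vw; elim: vw w' => {v w} [v vN|v u w vE def_u _ IH] w' vw'.
    by case: vw' vN => // v1 u1 w1 v1E; rewrite inE v1E.
  case: vw' vE def_u => [v1|v1 u1 w1 _ def_u1 uw1 _]; first by rewrite inE => /negPf->.
  by rewrite def_u1 => -[eq_u]; apply: IH; rewrite -eq_u.
have /choice[r rP] := lands_total; exists r; split.
- by move=> v; elim: (rP v).
- by move=> v vN; apply: lands_fun (rP v) _; exact: lands0.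
- by move=> v u vE def_u; apply: lands_fun (rP v) _; exact: landsS (rP u).
Qed.

Section LabeledTrees.
Variable A : finType.

Record atree := ATree {
  atree_tree :> tree;
  lab : A -> 'I_(nleaf atree_tree);
  lab_bij : bijective lab
}.

Definition leaf (T : atree) (a : A) : 'I_(nvert T) := att (lab T a).

(* The action on leaves is determined by the labels *)
Definition atree_iso (S T : atree) : Prop :=
  exists h : 'I_(nvert S) -> 'I_(nvert T),
    [/\ bijective h, forall v, out (h v) = omap h (out v) &
        forall a, leaf T a = h (leaf S a)].

(* T is obtained from S by collapsing the inner edges in E: c identifies the two
   ends of each edge in E, and each vertex of T comes from exactly one vertex of
   S whose outgoing edge is kept *)
Definition collapse (S : atree) (E : {set 'I_(nvert S)}) (T : atree) : Prop :=
  exists c : 'I_(nvert S) -> 'I_(nvert T),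
    [/\ {in ~: E &, injective c},
        forall y, exists2 v, v \in ~: E & c v = y,
        forall v, v \in E -> omap c (out v) = Some (c v),
        forall v, v \in ~: E -> out (c v) = omap c (out v) &
        forall a, leaf T a = c (leaf S a)].

Lemma atree_iso_refl T : atree_iso T T.
Proof.
exists id; split=> // [|v]; [by exists id | by case: (out v)].
Qed.

Lemma atree_iso_sym S T : atree_iso S T -> atree_iso T S.
Proof.
case=> h [[k hK kK] hout hleaf]; exists k; split=> [|v|a]; first by exists h.
  by rewrite -{2}[v]kK hout; case: (out (k v)) => //= w; rewrite hK.
by rewrite hleaf hK.
Qed.

Lemma atree_iso_trans T S U : atree_iso S T -> atree_iso T U -> atree_iso S U.
Proof.
case=> h [bh hout hleaf] [k [bk kout kleaf]]; exists (k \o h).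
split=> [|v|a]; first exact: bij_comp.
  by rewrite /= kout hout; case: (out v).
by rewrite kleaf hleaf.
Qed.

HB.instance Definition _ := gen_eqMixin atree.
HB.instance Definition _ := gen_choiceMixin atree.

Definition atree_isob (S T : atree) := `[< atree_iso S T >].

Lemma atree_isob_equiv : equiv_class_of atree_isob.
Proof.
split=> [T|S T|T S U]; first exact/asboolP/atree_iso_refl.
- by apply/asboolP/asboolP => /atree_iso_sym.
- by move=> /asboolP ST /asboolP TU; apply/asboolP; exact: atree_iso_trans ST TU.
Qed.

Canonical atree_isob_equivRel := EquivRelPack atree_isob_equiv.
Canonical atree_isob_encModRel := defaultEncModRel atree_isob.

Definition atree_class := {eq_quot atree_isob}.
HB.instance Definition _ : EqQuotient _ atree_isob atree_class :=
  EqQuotient.on atree_class.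
HB.instance Definition _ := Choice.on atree_class.

Lemma atree_piP S T : atree_iso S T <-> \pi_atree_class S = \pi_atree_class T.
Proof. by split=> [ST|/eqmodP/asboolP //]; apply/eqmodP/asboolP. Qed.

(* s is the set of vertices of the simplex given by S, i.e. the trees obtained by
   collapsing all inner edges of S but one. In a measured tree with a single inner
   edge, the edge has length 1, so that vertices need no lengths. The lengths of
   a measured tree of shape S are coordinates in the realization of the simplex. *)
Definition spans (S : atree) (s : {fset atree_class}) : Prop :=
  forall x, x \in s <->
    exists e T, [/\ e \in inner S, collapse (inner S :\ e) T & x = \pi T].

Definition tree_simplex (s : {fset atree_class}) : Prop :=
  exists S : atree, [/\ reduced S, inner S != set0 & spans S s].


Lemma collapse_exists (S : atree) (E : {set 'I_(nvert S)}) :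
  E \subset inner S -> exists T, collapse E T.
Proof.
move=> Ein; have [r [rN rid rE]] := lands_exists Ein.
pose c v : 'I_#|~: E| := enum_rank_in (rN (root S)) (r v).
have cK v : enum_val (c v) = r v by rewrite enum_rankK_in.
have c_inj : {in ~: E &, injective c}.
  by move=> v w vN wN /(congr1 (fun i => enum_val i)); rewrite !cK !rid.
have c_val (i : 'I_#|~: E|) : c (enum_val i) = i.
  by apply: enum_val_inj; rewrite cK rid // enum_valP.
have c_surj (i : 'I_#|~: E|) : exists2 v, v \in ~: E & c v = i.
  by exists (enum_val i) => //; exact: enum_valP.
have cE v : v \in E -> omap c (out v) = Some (c v).
  move=> vE; have := subsetP Ein v vE; rewrite inE.
  by case def_u: (out v) => [u|] //= _; rewrite /c (rE v u).
pose out' (i : 'I_#|~: E|) := omap c (out (enum_val i)).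
have cN v : v \in ~: E -> out' (c v) = omap c (out v).
  by move=> vN; rewrite /out' cK rid.
have rootN : root S \in ~: E.
  by rewrite inE; apply/negP => /(subsetP Ein); rewrite inE out_root.
have out'_root : out' (c (root S)) = None by rewrite cN ?out_root.
have rooted' (i : 'I_#|~: E|) : connect [rel v w | out' v == Some w] i (c (root S)).
  rewrite -(c_val i); elim/down_ind: (enum_val i) => v IH.
  have [vE|vN] := boolP (v \in E).
    by have := cE v vE; case def_u: (out v) => [u|] //= [<-]; exact: IH.
  have [->|v_root] := eqVneq v (root S); first exact: connect0.
  have vN' : v \in ~: E by rewrite inE.
  case def_u: (out v) => [u|].
    apply: connect_trans (IH u def_u); apply: connect1.
    by rewrite /= cN // def_u.
  have /connectP[[|w p] /=] := rooted v; last by rewrite def_u.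
  by move=> _ def_v; rewrite def_v eqxx in v_root.
pose att' l := c (att (t := S) l).
have no_nullary' i : arity out' att' i != 0%N.
  rewrite -lt0n; apply: (arity_collapse_ge c_inj c_surj cE cN (fun=> erefl)) => v.
  by rewrite lt0n; exact: no_nullary.
exists (@ATree (Tree out'_root rooted' no_nullary') (lab S) (lab_bij S)).
by exists c; split.
Qed.

Lemma reducedP (T : tree) : reduced T <-> forall v, (1 < arity (@out T) (@att T) v)%N.
Proof.
split=> [Tred v|T2 v]; last by rewrite neq_ltn T2 orbT.
by rewrite ltn_neqAle eq_sym Tred lt0n no_nullary.
Qed.

Lemma arity_leaf (T : atree) v : arity (@out T) (@att T) v = arity (@out T) (leaf T) v.
Proof.
rewrite !arityE; congr addn; rewrite (reindex (lab T)) //.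
by apply: onW_bij; exact: lab_bij.
Qed.

Lemma collapse_reduced (S T : atree) (E : {set 'I_(nvert S)}) :
  reduced S -> collapse E T -> reduced T.
Proof.
move=> /reducedP Sred [c [c_inj c_surj cE cN cleaf]]; apply/reducedP => v.
rewrite arity_leaf; apply: (arity_collapse_ge c_inj c_surj cE cN cleaf) => u.
by rewrite -arity_leaf; exact: Sred.
Qed.

Lemma collapse_uniq (S T U : atree) (E : {set 'I_(nvert S)}) :
  collapse E T -> collapse E U -> atree_iso T U.
Proof.
move=> [c [c_inj c_surj cE cN cleaf]] [d [d_inj d_surj dE dN dleaf]].
have /choice[k kP] : forall y, exists v, v \in ~: E /\ c v = y.
  by move=> y; have [v vN cv] := c_surj y; exists v.
have /choice[l lP] : forall y, exists v, v \in ~: E /\ d v = y.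
  by move=> y; have [v vN dv] := d_surj y; exists v.
have hc v : d (k (c v)) = d v.
  elim/down_ind: v => v IH; have [vE|vN] := boolP (v \in E).
    have := cE v vE; have := dE v vE; case def_u: (out v) => [u|] //= [<-] [<-].
    exact: IH.
  by case: (kP (c v)) => kN kc; congr d; apply: c_inj; rewrite // inE.
exists (d \o k); split=> [|y|a] /=; last by rewrite cleaf hc dleaf.
  exists (c \o l) => y /=.
    have [kN ky] := kP y; have [lN ld] := lP (d (k y)).
    by rewrite -[RHS]ky; congr c; exact: d_inj.
  by rewrite hc; case: (lP y).
have [kN <-] := kP y; rewrite hc dN // cN //; case: (out (k y)) => //= u.
by rewrite hc.
Qed.

Lemma collapse_comp (S T U : atree) (E : {set 'I_(nvert S)}) (c : 'I_(nvert S) -> 'I_(nvert T))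
    (F : {set 'I_(nvert T)}) :
  [/\ {in ~: E &, injective c},
        forall y, exists2 v, v \in ~: E & c v = y,
        forall v, v \in E -> omap c (out v) = Some (c v),
        forall v, v \in ~: E -> out (c v) = omap c (out v) &
        forall a, leaf T a = c (leaf S a)] ->
  collapse F U -> collapse (E :|: [set v in ~: E | c v \in F]) U.
Proof.
move=> [c_inj c_surj cE cN cleaf] [d [d_inj d_surj dE dN dleaf]].
exists (d \o c); split=> [v w|y|v|v|a] /=; last by rewrite dleaf cleaf.
- rewrite !inE !negb_or !negb_and !negbK => /andP[vE vF] /andP[wE wF].
  rewrite (negPf vE) /= in vF; rewrite (negPf wE) /= in wF.
  by move=> /d_inj /c_inj; rewrite !inE; apply.
- have [z zF <-] := d_surj y; have [v vE def_z] := c_surj z.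
  exists v; last by rewrite def_z.
  by move: zF vE; rewrite !inE def_z => /negPf-> /negPf->.
- rewrite !inE; have [vE _|vE /= vF] := boolP (v \in E).
    by have := cE v vE; case: (out v) => //= u [->].
  by have := dE _ vF; rewrite cN ?inE //; case: (out v).
- rewrite !inE negb_or negb_and negbK => /andP[vE]; rewrite (negPf vE) /= => vF.
  by rewrite dN ?inE // cN ?inE //; case: (out v).
Qed.

Lemma tree_simplex_neq0 s : tree_simplex s -> s != fset0.
Proof.
case=> S [_ /set0Pn[e eS] Ss].
have [T eT] : exists T, collapse (inner S :\ e) T.
  by apply: collapse_exists; exact: subsetDl.
by apply/fset0Pn; exists (\pi T); apply/Ss; exists e, T.
Qed.

Lemma tree_simplex_sub s t :
  tree_simplex s -> (t `<=` s)%fset -> t != fset0 -> tree_simplex t.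
Proof.
move=> [S [Sred S0 Ss]] /fsubsetP ts /fset0Pn[x0 x0t].
pose kept e := exists2 U, collapse (inner S :\ e) U & \pi U \in t.
pose K := [set e in inner S | `[< kept e >]].
have KS : K \subset inner S by apply/subsetP => e; rewrite inE => /andP[].
have [T [c cP]] : exists T, collapse (inner S :\: K) T.
  by apply: collapse_exists; exact: subsetDl.
have Tred : reduced T by apply: collapse_reduced Sred _; exists c; exact: cP.
have [c_inj c_surj cE cN _] := cP.
have innerT v : v \in ~: (inner S :\: K) -> (c v \in inner T) = (v \in K).
  move=> vN; rewrite inE cN //; move: vN; rewrite !inE.
  by case: (out v) => //= u; rewrite andbT negbK.
have KN v : v \in K -> v \in ~: (inner S :\: K) by move=> vK; rewrite !inE in vK *; rewrite vK.
have comp e U : e \in K -> collapse (inner T :\ c e) U -> collapse (inner S :\ e) U.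
  move=> eK /(collapse_comp cP); congr collapse; apply/setP => v.
  have [vN|] := boolP (v \in ~: (inner S :\: K)); last first.
    rewrite in_setC negbK => vE; rewrite in_setU vE in_setD1.
    move: vE; rewrite in_setD => /andP[vK ->]; rewrite andbT; apply/esym.
    by apply: contraNneq vK => ->.
  rewrite in_setU [v \in [set _ in _ | _]]inE vN /= -[v \in _ :\: _]negbK -in_setC vN /=.
  rewrite !in_setD1 innerT // (inj_in_eq c_inj) ?(KN e) //; congr andb.
  apply/idP/idP => [/(subsetP KS) //|vS].
  by move: vN; rewrite in_setC in_setD vS andbT negbK.
exists T; split=> //.
  have /Ss[e [U [eS eU def_x0]]] := ts _ x0t.
  apply/set0Pn; exists (c e).
  have eK : e \in K by rewrite inE eS; apply/asboolP; exists U; rewrite -?def_x0.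
  by rewrite innerT ?KN.
move=> x; split=> [xt|[f [U [fT fU ->]]]].
  have /Ss[e [U [eS eU def_x]]] := ts _ xt.
  have eK : e \in K by rewrite inE eS; apply/asboolP; exists U; rewrite -?def_x.
  have [U' eU'] : exists U', collapse (inner T :\ c e) U'.
    by apply: collapse_exists; exact: subsetDl.
  exists (c e), U'; rewrite innerT ?KN // def_x; split=> //.
  exact/atree_piP/(collapse_uniq eU)/comp.
have [e eN def_f] := c_surj f; rewrite -def_f innerT // in fT; rewrite -def_f in fU.
have := fT; rewrite inE => /andP[_ /asboolP[U' eU' U't]].
by have /atree_piP -> := collapse_uniq (comp e U fT fU) eU'.
Qed.

End LabeledTrees.

Section TreeComplex.
Variables (gT : finGroupType) (A : finType) (to : lact gT A).

Lemma relabel_bij g (T : atree A) : bijective (lab T \o to g^-1%g).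
Proof. exact: bij_comp (lab_bij T) (lop_bij to _). Qed.

Definition relabel g (T : atree A) : atree A := ATree (relabel_bij g T).

Lemma relabel_iso g S T : atree_iso S T -> atree_iso (relabel g S) (relabel g T).
Proof.
case=> h [bh hout hleaf]; exists h; split=> // a.
exact: (hleaf (to g^-1%g a)).
Qed.

Definition class_op g (x : atree_class A) : atree_class A :=
  \pi_(atree_class A) (relabel g (repr x)).

Lemma class_opE g T :
  class_op g (\pi_(atree_class A) T) = \pi_(atree_class A) (relabel g T).
Proof. by apply/atree_piP/relabel_iso/atree_piP; rewrite reprK. Qed.

Lemma class_op1 x : class_op 1%g x = x.
Proof.
rewrite -[x]reprK class_opE; apply/atree_piP; set T := repr x.
exists id; split=> [|v|a]; first by exists id.
  by rewrite /=; case: (out v).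
by rewrite /leaf /= invg1 lop1.
Qed.

Lemma class_opM g h x : class_op (g * h)%g x = class_op g (class_op h x).
Proof.
rewrite -[x]reprK class_opE (class_opE h) class_opE; apply/atree_piP.
set T := repr x; exists id; split=> [|v|a]; first by exists id.
  by rewrite /=; case: (out v).
by rewrite /leaf /= invMg lopM.
Qed.

Definition class_act : lact gT (atree_class A) := Lact class_op1 class_opM.

Lemma collapse_relabel g (S T : atree A) (E : {set 'I_(nvert S)}) :
  collapse E T -> collapse (S := relabel g S) E (relabel g T).
Proof.
case=> c [c_inj c_surj cE cN cleaf]; exists c; split=> // a.
exact: (cleaf (to g^-1%g a)).
Qed.

Lemma tree_simplexG g (s : {fset atree_class A}) :
  tree_simplex s -> tree_simplex [fset class_act g x | x in s]%fset.
Proof.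
case=> S [Sred S0 Ss]; exists (relabel g S); split=> // x.
split=> [/imfsetP[_ /= /Ss[e [T [eS eT ->]]] ->]|[e [T [eS eT ->]]]].
  by exists e, (relabel g T); rewrite class_opE; split=> //; exact: collapse_relabel.
have [U eU] : exists U, collapse (inner S :\ e) U.
  by apply: collapse_exists; exact: subsetDl.
apply/imfsetP; exists (\pi_(atree_class A) U); first by apply/Ss; exists e, U.
rewrite /= class_opE; apply/atree_piP/(collapse_uniq eT).
exact: collapse_relabel.
Qed.

Definition tree_complex : gcomplex gT :=
  GComplex (@tree_simplex_neq0 A) (@tree_simplex_sub A) tree_simplexG.

End TreeComplex.

(* Main.v *)
Require Import Defs.
From mathcomp Require Import all_boot all_fingroup all_algebra.
From mathcomp Require Import finmap generic_quotient ring_quotient.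
From mathcomp Require Import boolp functions freeg zify ring.

Set Implicit Arguments.
Unset Strict Implicit.
Unset Printing Implicit Defensive.

Import GRing.Theory.
Local Open Scope ring_scope.
Local Open Scope quotient_scope.

(** The complex of trees has dimension [n - 3], so that its top cohomology is
    presented by generators and relations: the generators are the oriented binary
    trees, and each tree with a single ternary vertex gives a relation between the
    three binary trees that collapse to it. The module [Lie] is generated by the
    bracketings of the elements of [A], which are planar binary trees, with
    antisymmetry and the Jacobi identity as relations. The two presentations agree
    up to the signs of the orders of the leaves, whence the twist by [epsilon].

    The proof compares the two sides without presenting the second one: both are
    embedded in the functions on words, that is, on linear orders of [A]. On the
    Lie side, an element is sent to the coefficients of its expansion in the free
    associative algebra ([wcoef]). On the side of cohomology, the planar trees with
    a given order [w] of the leaves form a sphere, and a cochain is evaluated on its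
    fundamental cycle ([sphere], [sphere_bd]); with the sign of [w], this is
    [pairing]. Both maps are equivariant up to the sign.

    Fix a letter [a0]. Left-normed brackets that start with [a0] span [Lie] by the
    Jacobi identity ([Lie_expand]), and they are independent because each one has
    a single word that starts with [a0] in its expansion ([wcoef_left_normed]).
    In cohomology, the combs in which [a0] is farthest from the root span ([cochain_spanned]): in
    a binary tree, take a maximal inner edge without [a0] above it and apply the
    relation of the tree in which it is collapsed; the other two trees have fewer
    such edges. Finally a comb has the same values on words as the corresponding
    bracket ([wcoef_comb]). Hence both images are the span of the same
    functions, and both maps are injective.

    All of this is done in terms of sets of leaves. A reduced tree is determined by
    the sets of leaves above its inner edges, its clades, and a family of subsets of
    [A] with more than one and less than [n] elements comes from a tree if and only
    if any two of its members are nested or disjoint ([tree_simplexP]). *)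

(** * Chains of planar binary trees *)

Section Boundary.
Variable T : Type.
Implicit Types (psi : seq T -> int) (s t : seq T).

(** The formula of the coboundary for sequences that need not be simplices, so that it
    can be evaluated on parts of a simplex. *)
Definition bd psi s : int :=
  \sum_(i < size s) (-1) ^+ i * psi (take i s ++ drop i.+1 s).

Lemma bd_cons psi x s : bd psi (x :: s) = psi s - bd (fun s' => psi (x :: s')) s.
Proof.
rewrite /bd big_ord_recl /= drop0 mul1r -sumrN; congr (_ + _).
by apply: eq_bigr => i _; rewrite exprS mulN1r mulNr.
Qed.

(** The graded Leibniz rule for the concatenation of sequences. *)
Lemma bd_cat psi s t :
  bd psi (s ++ t) = bd (fun s' => psi (s' ++ t)) s +
                    (-1) ^+ size s * bd (fun t' => psi (s ++ t')) t.
Proof.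
elim: s psi => [|x s IHs] psi /=; first by rewrite /bd big_ord0 add0r mul1r.
by rewrite !bd_cons IHs exprS mulN1r mulNr opprD addrA.
Qed.

End Boundary.

Section Chains.
Variable A : finType.
Implicit Types (w u v : seq A) (C D : {set A}) (psi : seq {set A} -> int).

(** The sum, with signs, of the values of [psi] on the sequences of vertices of all
    planar binary trees with leaves [w], a vertex being recorded as the set of the
    leaves above it. Each tree lists its root, then the vertices of its left part,
    then those of its right part; each splitting has the sign given by the parity of
    the number of vertices of the left part. Chains are encoded as functionals of [psi], so that
    substitution is composition; [k] bounds the size of [w]. *)
Fixpoint cone_rec k w psi : int :=
  if (size w <= 1)%N then psi [::] else
  if k is k'.+1 then
    \sum_(1 <= i < size w) (-1) ^+ i.-1 *
      cone_rec k' (take i w) (fun s => cone_rec k' (drop i w)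
        (fun t => psi ([set x in w] :: s ++ t)))
  else 0.

Definition cone w := cone_rec (size w) w.

(** The cone without its apex, the set of all letters. It is the fundamental cycle of
    the sphere formed by the planar trees with leaves [w], the boundary of the dual
    of an associahedron. *)
Definition sphere w psi : int :=
  \sum_(1 <= i < size w) (-1) ^+ i.-1 *
    cone (take i w) (fun s => cone (drop i w) (fun t => psi (s ++ t))).

Lemma cone_recE k w psi : (size w <= k)%N -> cone_rec k w psi = cone w psi.
Proof.
elim/ltn_ind: k w psi => k IH w psi; rewrite leq_eqVlt => /predU1P[<- //|lt_wk].
case: k IH lt_wk => // k IH lt_wk; rewrite /cone /=; case: leqP => [le_w1|lt_1w].
  by case: w le_w1 {lt_wk} => [|x [|//]].
case def_n: (size w) lt_1w lt_wk => [|n] //=; rewrite def_n => lt_1n; rewrite ltnS => lt_nk.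
rewrite leqNgt lt_1n /=; apply: eq_big_nat => i /andP[i0 ltin]; congr (_ * _).
have szt : (size (take i w) <= n)%N by rewrite size_take def_n; case: ltnP => //; lia.
have szd : (size (drop i w) <= n)%N by rewrite size_drop def_n; lia.
rewrite [LHS](IH k) ?ltnSn ?(leq_trans szt) ?(ltnW lt_nk) //.
rewrite [RHS](IH n) ?(leq_trans lt_nk) //; congr (cone _ _).
apply/funext => s.
rewrite (IH k) ?ltnSn ?(leq_trans szd) ?(ltnW lt_nk) //.
by rewrite (IH n) ?(leq_trans lt_nk).
Qed.

Lemma cone1 w psi : (size w <= 1)%N -> cone w psi = psi [::].
Proof. by rewrite /cone; case: w => [|x [|y w]]. Qed.

Lemma coneE w psi : (1 < size w)%N ->
  cone w psi = sphere w (fun s => psi ([set x in w] :: s)).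
Proof.
move=> w1; rewrite /cone; case def_n: (size w) w1 => [|n] //= lt1n.
rewrite def_n leqNgt lt1n /= /sphere def_n; apply: eq_big_nat => i /andP[i0 ltin].
congr (_ * _); rewrite cone_recE.
  congr (cone _ _); apply/funext => s; rewrite cone_recE //.
  by rewrite size_drop def_n; lia.
by rewrite size_take def_n; case: ltnP => //; lia.
Qed.

Lemma word_ind (P : seq A -> Prop) :
  (forall w, (forall i, (0 < i < size w)%N -> P (take i w) /\ P (drop i w)) -> P w) ->
  forall w, P w.
Proof.
move=> IH w; have [k] := ubnP (size w); elim: k w => // k IHk w lt_wk.
apply: IH => i /andP[i0 ltiw]; split; apply: IHk.
  by rewrite size_take ltiw; lia.
by rewrite size_drop; lia.
Qed.

Lemma cone_lin w (a : int) f g :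
  cone w (fun s => a * f s + g s) = a * cone w f + cone w g.
Proof.
elim/word_ind: w f g => w IH f g; have [w1|w1] := leqP (size w) 1; first by rewrite !cone1.
rewrite !coneE // /sphere big_distrr -big_split; apply: eq_big_nat => i iw /=.
have [IHt IHd] := IH i iw.
rewrite (_ : (fun s => cone (drop i w) _) = fun s =>
    a * cone (drop i w) (fun t => f ([set x in w] :: s ++ t)) +
    cone (drop i w) (fun t => g ([set x in w] :: s ++ t))); first by rewrite IHt; ring.
by apply/funext => s; rewrite IHd.
Qed.

Lemma cone0 w : cone w (fun _ => 0) = 0.
Proof.
rewrite -[RHS](addNr (cone w (fun=> 0))) -mulN1r -cone_lin; congr cone.
Qed.

Lemma cone_sum (I : Type) (r : seq I) (P : pred I) (c : I -> int) (f : I -> seq {set A} -> int) w :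
  cone w (fun s => \sum_(i <- r | P i) c i * f i s) = \sum_(i <- r | P i) c i * cone w (f i).
Proof.
elim: r => [|x r IH].
  by rewrite big_nil -[RHS](cone0 w); congr cone; apply/funext => s; rewrite big_nil.
rewrite big_cons; case Px: (P x); rewrite -IH.
  by rewrite -cone_lin; congr cone; apply/funext => s; rewrite big_cons Px.
by congr cone; apply/funext => s; rewrite big_cons Px.
Qed.

Lemma sphere_lin w (a : int) f g :
  sphere w (fun s => a * f s + g s) = a * sphere w f + sphere w g.
Proof.
rewrite /sphere big_distrr -big_split; apply: eq_big_nat => i iw /=.
rewrite (_ : (fun s => cone (drop i w) _) = fun s =>
    a * cone (drop i w) (fun t => f (s ++ t)) +
    cone (drop i w) (fun t => g (s ++ t))); first by rewrite cone_lin; ring.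
by apply/funext => s; rewrite cone_lin.
Qed.

Definition compat C D := [|| C \subset D, D \subset C | [disjoint C & D]].

Lemma compatC C D : compat C D = compat D C.
Proof. by rewrite /compat disjoint_sym orbCA. Qed.

Definition laminar (s : seq {set A}) : Prop := {in s &, forall C D, compat C D}.

(** The sequences on which a cone evaluates its argument list the sets of leaves
    above the vertices of a tree. These are nested or disjoint, and distinct because
    the two parts of a word without repetitions are disjoint and nonempty. *)
Lemma eq_cone w f g : uniq w ->
  (forall s, [/\ size s = (size w).-1, uniq s,
     {in s, forall C, C \subset [set x in w] /\ (1 < #|C|)%N} & laminar s] -> f s = g s) ->
  cone w f = cone w g.
Proof.
elim/word_ind: w f g => w IH f g Uw fg; have [w1|w1] := leqP (size w) 1.
  by rewrite !cone1 // fg //; split => //; case: w w1 {IH fg Uw} => [|x [|//]].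
rewrite !coneE // /sphere; apply: eq_big_nat => i iw; congr (_ * _).
have [IHt IHd] := IH i iw; have /andP[i0 ltiw] := iw.
have [Ut [dis Ud]] : uniq (take i w) /\ [disjoint [set x in take i w] & [set x in drop i w]] /\ uniq (drop i w).
  move: Uw; rewrite -{1}(cat_take_drop i w) cat_uniq => /and3P[-> /hasPn dis ->]; split=> //; split=> //.
  by rewrite disjoint_subset; apply/subsetP => x; rewrite !inE => xt; apply: contraL xt; apply: dis.
apply: IHt => // s [szs Us sP sL]; apply: IHd => // t [szt Ut' tP tL].
have subt C : C \subset [set x in take i w] -> C \subset [set x in w].
  by move=> /subsetP sC; apply/subsetP => x /sC; rewrite !inE => /mem_take.
have subd C : C \subset [set x in drop i w] -> C \subset [set x in w].
  by move=> /subsetP sC; apply/subsetP => x /sC; rewrite !inE => /mem_drop.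
have disC C D : C \in s -> D \in t -> [disjoint C & D].
  move=> /sP[sC _] /tP[sD _]; apply: disjointWl sC _; exact: disjointWr sD dis.
have ex v : (0 < size v)%N -> exists x, x \in v.
  by case: v => // x v _; exists x; rewrite mem_head.
have [x xt] : exists x, x \in take i w by apply: ex; rewrite size_takel // ltnW.
have [y yd] : exists y, y \in drop i w by apply: ex; rewrite size_drop; lia.
have noboth z : z \in take i w -> z \in drop i w -> False.
  move=> zt zd; have /pred0P/(_ z) := dis; by rewrite /= !inE zt zd.
have st C : C \in s ++ t -> [/\ C \subset [set x in w], (1 < #|C|)%N & C != [set x in w]].
  rewrite mem_cat => /orP[/sP[sC C1]|/tP[sC C1]]; split=> //; [exact: subt| |exact: subd|].
    apply/negP => /eqP def_C; apply: (noboth y) => //.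
    by have := subsetP sC y; rewrite def_C !inE (mem_drop yd) => /(_ isT).
  apply/negP => /eqP def_C; apply: (noboth x) => //.
  by have := subsetP sC x; rewrite def_C !inE (mem_take xt) => /(_ isT).
apply: fg; split.
- by rewrite /= size_cat szs szt (size_takel (ltnW ltiw)) size_drop; lia.
- rewrite /= cat_uniq Us Ut' andbT; have -> /= : [set x in w] \notin s ++ t.
    by apply/negP => /st[_ _]; rewrite eqxx.
  apply/hasPn => C Ct; apply/negP => Cs; have := disC _ _ Cs Ct.
  have /st[_ C1 _] : C \in s ++ t by rewrite mem_cat Ct orbT.
  by rewrite -setI_eq0 setIid -cards_eq0; case: #|C| C1.
- move=> C; rewrite inE => /predU1P[->|/st[sC C1 _]]; split=> //.
  by rewrite cardsE (card_uniqP Uw).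
- move=> C D; rewrite !inE => /predU1P[->|Cs] /predU1P[->|Ds]; rewrite /compat ?subxx //.
  + by have [-> _ _] := st D Ds; rewrite orbT.
  + by have [-> _ _] := st C Cs; rewrite ?orbT.
  move: Cs Ds; rewrite !mem_cat => /orP[Cs|Ct] /orP[Ds|Dt].
  + exact: sL.
  + by rewrite disC ?orbT.
  + by rewrite disjoint_sym disC ?orbT.
  + exact: tL.
Qed.

Lemma eq_sphere w f g : uniq w -> (1 < size w)%N ->
  (forall s, [/\ size s = (size w).-2, uniq s,
     {in s, forall C, C \proper [set x in w] /\ (1 < #|C|)%N} & laminar s] -> f s = g s) ->
  sphere w f = sphere w g.
Proof.
move=> Uw w1 fg.
(* The sequences that occur in the cone start with the set of all letters. *)
pose F h s : int := if head set0 s == [set x in w] then h (behead s) else 0.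
have coneF h : sphere w h = cone w (F h).
  rewrite coneE //; congr sphere; apply/funext => s.
  by rewrite /F /= eqxx.
rewrite !coneF; apply: eq_cone => // s [szs Us sP sL]; rewrite /F; case: eqP => // hd.
case: s szs Us sP sL hd => [|C s] /= szs; first by case: (size w) szs w1 => [|[|]].
case/andP=> Cs Us sP sL hd; apply: fg; split=> //; first by rewrite -szs.
  move=> D Ds; have [|sD D1] := sP D; first by rewrite inE Ds orbT.
  split=> //.
  by rewrite properEneq sD andbT; apply: contraNneq Cs => def_D; rewrite hd -def_D.
by move=> D E Ds Es; apply: sL; rewrite inE ?Ds ?Es orbT.
Qed.

Lemma cone_bd w psi : sphere w (bd (fun s => psi ([set x in w] :: s))) = 0 ->
  cone w (bd psi) = sphere w psi.
Proof.
move=> w0; have [w1|w1] := leqP (size w) 1.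
  by rewrite cone1 // /bd big_ord0 /sphere big_geq.
rewrite coneE // -[RHS]add0r -[X in X + _](mulr0 (-1)) -w0 -sphere_lin.
by congr sphere; apply/funext => s; rewrite bd_cons mulN1r addrC.
Qed.

(** By the Leibniz rule, the boundary of a term consists of the terms of the
    boundaries of its two parts, which cut the word in three. Each way to cut it in
    three arises twice, from the bracketings (xy)z and x(yz), with opposite signs. *)
Lemma sphere_bd w psi : uniq w -> sphere w (bd psi) = 0.
Proof.
elim/word_ind: w psi => w IH psi Uw; set n := size w.
pose G a b := cone (take a w) (fun s1 => cone (drop a (take b w)) (fun s2 =>
  cone (drop b w) (fun t => psi ((s1 ++ s2) ++ t)))).
have term i : (0 < i < n)%N ->
    cone (take i w) (fun s => cone (drop i w) (fun t => bd psi (s ++ t))) =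
    \sum_(1 <= j < i) (-1) ^+ j.-1 * G j i +
    (-1) ^+ i.-1 * \sum_(i.+1 <= k < n) (-1) ^+ (k - i).-1 * G i k.
  move=> iw; have [IHt IHd] := IH i iw; have /andP[i0 ltin] := iw.
  have [Ut Ud] : uniq (take i w) /\ uniq (drop i w) by rewrite take_uniq ?drop_uniq.
  have -> : cone (take i w) (fun s => cone (drop i w) (fun t => bd psi (s ++ t))) =
    cone (take i w) (fun s => (-1) ^+ i.-1 * sphere (drop i w) (fun t => psi (s ++ t)) +
      bd (fun s' => cone (drop i w) (fun t => psi (s' ++ t))) s).
    apply: eq_cone => // s [szs _ _ _].
    have -> : bd (fun s' => cone (drop i w) (fun t => psi (s' ++ t))) s =
        cone (drop i w) (fun t => bd (fun s' => psi (s' ++ t)) s).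
      exact: esym (cone_sum _ _ _ _ _).
    have <- := @cone_bd (drop i w) (fun t => psi (s ++ t)) (IHd _ Ud).
    rewrite -cone_lin; congr cone; apply/funext => t.
    by rewrite bd_cat szs size_takel ?(ltnW ltin) // addrC.
  rewrite cone_lin cone_bd ?IHt // addrC; congr (_ + _ * _).
    rewrite /sphere size_takel ?(ltnW ltin) //; apply: eq_big_nat => j /andP[_ ltji].
    by rewrite take_takel ?(ltnW ltji).
  rewrite /sphere size_drop -/n cone_sum -[i.+1]add1n big_addn.
  apply: eq_big_nat => j _; rewrite addnK; congr (_ * _); rewrite /G -take_drop -drop_drop.
  congr cone; apply/funext => s1; congr cone; apply/funext => s2; congr cone.
  by apply/funext => t; rewrite catA.
rewrite /sphere -/n (eq_big_nat _ _ (fun i iw => congr1 ( *%R ((-1) ^+ i.-1)) (term i iw))).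
rewrite (eq_bigr _ (fun i _ => mulrDr _ _ _)) big_split /=.
have -> : \sum_(1 <= i < n) (-1) ^+ i.-1 * (\sum_(1 <= j < i) (-1) ^+ j.-1 * G j i) =
    \sum_(1 <= i < n) \sum_(1 <= j < n) (if (j < i)%N then (-1) ^+ (i.-1 + j.-1) * G j i else 0).
  apply: eq_big_nat => i /andP[i0 ltin]; rewrite (big_nat_widen _ _ n) ?(ltnW ltin) //=.
  rewrite big_mkcond big_distrr; apply: eq_bigr => j _.
  by case: ifP => _ /=; rewrite ?mulr0 // exprD mulrA.
rewrite exchange_big /= -big_split; apply: big1_seq => i.
rewrite mem_index_iota => /andP[_ /andP[i0 ltin]] /=.
rewrite mulrA -exprD addnn -mul2n exprM sqrrN !expr1n mul1r.
have -> : \sum_(i.+1 <= k < n) (-1) ^+ (k - i).-1 * G i k =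
    \sum_(1 <= k < n) (if (i < k)%N then (-1) ^+ (k - i).-1 * G i k else 0).
  by rewrite (big_nat_widenl _ 1) // big_mkcond.
rewrite -big_split; apply: big1_seq => k; rewrite mem_index_iota => /andP[_ /andP[k0 ltkn]] /=.
case: ifP => [ltik|_]; last by rewrite addr0.
rewrite -mulrDl (_ : (k.-1 + i.-1 = (k - i).-1.+1 + i.-1.*2)%N); last by lia.
by rewrite exprD exprS -mul2n (exprM _ 2) sqrrN !expr1n mulr1 mulN1r addNr mul0r.
Qed.

Lemma sphere_scale w (a : int) f : sphere w (fun s => a * f s) = a * sphere w f.
Proof.
rewrite /sphere big_distrr; apply: eq_bigr => i _ /=; rewrite mulrCA; congr (_ * _).
have scale v h : cone v (fun s => a * h s) = a * cone v h.
  rewrite -[RHS]addr0 -[X in _ + X](cone0 v) -cone_lin; congr cone.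
  by apply/funext => s; rewrite addr0.
by rewrite -scale; congr cone; apply/funext => s; rewrite scale.
Qed.

Lemma sphereB w f g : sphere w (fun s => f s - g s) = sphere w f - sphere w g.
Proof.
rewrite addrC -mulN1r -sphere_lin; congr sphere.
by apply/funext => s; rewrite mulN1r addrC.
Qed.

End Chains.

Section Naturality.
Variables (A B : finType) (h : A -> B).
Implicit Types (w : seq A).

Lemma cone_map w psi : cone (map h w) psi = cone w (fun s => psi [seq h @: C | C : {set A} <- s]).
Proof.
elim/word_ind: w psi => w IH psi; have [w1|w1] := leqP (size w) 1.
  by rewrite !cone1 ?size_map.
rewrite !coneE ?size_map // /sphere size_map; apply: eq_big_nat => i iw.
have [IHt IHd] := IH i iw; rewrite -map_take -map_drop IHt; congr (_ * cone _ _).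
apply/funext => s; rewrite IHd; congr cone; apply/funext => t.
rewrite /= map_cat; congr (psi (_ :: _)); apply/setP => b; rewrite inE.
by apply/mapP/imsetP => -[a]; rewrite ?inE => aw ->; exists a; rewrite ?inE.
Qed.

Lemma sphere_map w psi :
  sphere (map h w) psi = sphere w (fun s => psi [seq h @: C | C : {set A} <- s]).
Proof.
rewrite /sphere size_map; apply: eq_bigr => i _; rewrite -map_take -map_drop cone_map.
congr (_ * cone _ _); apply/funext => s; rewrite cone_map; congr cone.
by apply/funext => t; rewrite map_cat.
Qed.

End Naturality.

(** * Signs of rearrangements *)

Section PermutationSign.
Variable T : eqType.
Implicit Types (s t r : seq T) (x y : T).

(** The sign of the permutation that carries [t] to [s]. As a determinant it is zero
    if there is none, it is alternating in both arguments, and it obeys Laplace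
    expansion, which is what relates it to the coboundary. *)
Definition psign s t : int :=
  if size s == size t then
    if s is x0 :: _ then
      \det (\matrix_(i < size s, j < size s) (nth x0 s i == nth x0 t j)%:R) else 1
  else 0.

Lemma psignE x0 n s t : size s = n -> size t = n ->
  psign s t = \det (\matrix_(i < n, j < n) (nth x0 s i == nth x0 t j)%:R).
Proof.
move=> <- szt; rewrite /psign szt eqxx; case: s szt => [|y s] szt; first by rewrite det_mx00.
congr (\det _); apply/matrixP => i j; rewrite !mxE.
by rewrite (set_nth_default x0) // (set_nth_default x0 y) // szt.
Qed.

Lemma psign_size s t : size s != size t -> psign s t = 0.
Proof. by rewrite /psign => /negPf->. Qed.

Lemma psign0 : psign [::] [::] = 1. Proof. by []. Qed.

Lemma size_del i s : (i < size s)%N -> size (take i s ++ drop i.+1 s) = (size s).-1.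
Proof. by move=> ltis; rewrite size_cat (size_takel (ltnW ltis)) size_drop; lia. Qed.

Lemma nth_del x0 i s j : (i < size s)%N -> nth x0 (take i s ++ drop i.+1 s) j = nth x0 s (bump i j).
Proof.
move=> ltis; rewrite nth_cat (size_takel (ltnW ltis)) /bump; case: ltnP => [ltji|leij].
  by rewrite nth_take // add0n.
by rewrite nth_drop add1n; congr nth; lia.
Qed.

(** Laplace expansion along the first column. *)
Lemma psign_consr x s t :
  psign s (x :: t) = \sum_(i < size s) (-1) ^+ i * (nth x s i == x)%:R *
                       psign (take i s ++ drop i.+1 s) t.
Proof.
have [szst|nesz] := eqVneq (size s) (size (x :: t)); last first.
  rewrite psign_size // big1 // => i _; rewrite [psign (_ ++ _) _]psign_size ?mulr0 //.
  by rewrite size_del //; apply: contra_neq nesz => /=; have := ltn_ord i; lia.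
rewrite (psignE x szst) // (expand_det_col _ ord0) szst; apply: eq_bigr => i _; rewrite !mxE /cofactor.
rewrite addn0 mulrCA mulrA; congr (_ * _).
rewrite (psignE x (n := size t)) //; last by rewrite size_del szst.
congr (\det _); apply/matrixP => j k; rewrite !mxE.
by rewrite nth_del ?szst.
Qed.

Lemma psign_consl x s t (tx : x \notin s) y : psign (y :: s) (x :: t) = (y == x)%:R * psign s t.
Proof.
rewrite psign_consr big_ord_recl /= drop0 expr0 mul1r big1 ?addr0 // => i _.
have /negPf-> : nth x s i != x by apply: contraNneq tx => <-; rewrite mem_nth.
by rewrite mulr0 mul0r.
Qed.

Lemma psign_refl t : uniq t -> psign t t = 1.
Proof.
elim: t => //= x t IHt /andP[tx Ut].
by rewrite psign_consl // eqxx mul1r IHt.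
Qed.

Lemma psign_perm_eq s t : psign s t != 0 -> perm_eq s t.
Proof.
elim: t s => [|x t IHt] s.
  by case: s => // x s; rewrite psign_size ?eqxx.
apply: contraR => not_st; rewrite psign_consr big1 // => i _.
have [def_x|] := eqVneq; last by rewrite mulr0 mul0r.
have [->|/IHt st] := eqVneq (psign (take i s ++ drop i.+1 s) t) 0; first by rewrite mulr0.
case/negP: not_st; rewrite -{1}(cat_take_drop i s) (drop_nth x) // def_x.
by rewrite perm_catC /= perm_cons perm_catC.
Qed.

(** The incidence matrices multiply, as each entry of [s] occurs once in [u]. *)
Lemma psign_mul u s t : uniq u -> perm_eq s u -> psign s u * psign u t = psign s t.
Proof.
case: u => [|x0 u0] Uu pu.
  by rewrite (perm_nilP pu) psign0 mul1r.
move: (x0 :: u0) Uu pu => u Uu pu.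
have [szt|nesz] := eqVneq (size t) (size u); last first.
  by rewrite [psign s t]psign_size ?[psign u t]psign_size ?mulr0 // ?(perm_size pu) eq_sym.
rewrite !(psignE x0 (n := size u)) // ?(perm_size pu) // -det_mulmx; congr (\det _).
apply/matrixP => i j; rewrite !mxE.
have si_u : nth x0 s i \in u by rewrite -(perm_mem pu) mem_nth // (perm_size pu).
have k_lt : (index (nth x0 s i) u < size u)%N by rewrite index_mem.
rewrite (bigD1 (Ordinal k_lt)) //= !mxE /= nth_index // eqxx mul1r big1 ?addr0 // => k ne_k.
rewrite !mxE; case: eqP => [def_k|_]; last by rewrite mul0r.
case/eqP: ne_k; apply: val_inj => /=; by rewrite def_k index_uniq.
Qed.

Lemma psign_sym s t : psign s t = psign t s.
Proof.
have [szst|nesz] := eqVneq (size s) (size t); last by rewrite !psign_size // eq_sym.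
case: s szst => [|x0 s0]; first by case: t.
move: (x0 :: s0) => s szst; rewrite !(psignE x0 (n := size t)) // -det_tr.
by congr (\det _); apply/matrixP => i j; rewrite !mxE eq_sym.
Qed.

Lemma psign_tuple m (t : m.-tuple T) (p : 'S_m) r :
  psign [tuple tnth t (p i) | i < m] r = (-1) ^+ p * psign t r.
Proof.
have [szr|nesz] := eqVneq (size r) m; last first.
  by rewrite !psign_size ?mulr0 // size_tuple eq_sym.
case: m t p szr => [|m] t p szr.
  by rewrite tuple0 (tuple0 t) (size0nil szr) psign0 mulr1 (_ : p = 1%g) ?odd_perm1 //; apply/permP => -[].
rewrite !(psignE (thead t) (n := m.+1)) ?size_tuple //.
rewrite -det_perm -det_mulmx; congr (\det _); rewrite -row_permE; apply/matrixP => i j.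
by rewrite !mxE -!tnth_nth tnth_mktuple.
Qed.

Lemma psign_rcons2 b s t : b \notin t -> psign (rcons s b) (rcons t b) = psign s t.
Proof.
elim: t s => [|x t IHt] s.
  move=> _; case: s => [|y s]; first by rewrite psign_refl.
  by rewrite !psign_size //= size_rcons.
rewrite inE negb_or => /andP[ne_bx tb] /=.
rewrite !psign_consr size_rcons big_ord_recr /= nth_rcons ltnn eqxx (negPf ne_bx).
rewrite mulr0 mul0r addr0; apply: eq_bigr => i _; rewrite nth_rcons ltn_ord; congr (_ * _).
rewrite -IHt // rcons_cat -!cats1 take_cat ltn_ord; congr (psign (_ ++ _) _).
rewrite drop_cat; case: ltnP => // ge_s; rewrite (drop_oversize ge_s).
by have -> : (i.+1 - size s = 0)%N by have := ltn_ord i; lia.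
Qed.

Lemma psign_cons_rcons b s t : b \notin t ->
  psign (b :: s) (rcons t b) = (-1) ^+ size s * psign s t.
Proof.
elim: t s => [|x t IHt] s.
  move=> _; case: s => [|y s] /=; first by rewrite !psign_refl ?mul1r.
  by rewrite [LHS]psign_size // [psign (y :: s) _]psign_size // mulr0.
rewrite inE negb_or => /andP[ne_bx tb] /=.
rewrite !psign_consr big_ord_recl /= (negPf ne_bx) mulr0 mul0r add0r big_distrr.
apply: eq_bigr => i _; have lti : (i < size s)%N := ltn_ord i.
rewrite IHt // /bump leq0n add1n add0n size_del //= exprS.
have -> : (-1) ^+ size s = - (-1) ^+ (size s).-1 :> int.
  by rewrite -[in LHS](@prednK (size s)) ?exprS ?mulN1r //; lia.
by ring.
Qed.

End PermutationSign.

Lemma psign_map (T U : eqType) (f : T -> U) (s t : seq T) :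
  {in s & t, forall x y, f x = f y -> x = y} -> psign (map f s) (map f t) = psign s t.
Proof.
move=> f_inj; have [szst|nesz] := eqVneq (size s) (size t); last by rewrite !psign_size ?size_map.
case: s szst f_inj => [|x0 s0]; first by case: t.
move: (x0 :: s0) => s szst f_inj.
rewrite (psignE (f x0) (n := size t)) ?size_map // (psignE x0 szst) //.
congr (\det _); apply/matrixP => i j; rewrite !mxE !(nth_map x0) ?szst //.
congr (nat_of_bool _)%:R; apply/eqP/eqP => [|-> //]; apply: f_inj; by rewrite mem_nth ?szst.
Qed.

(** * Expansions of elements of the free Lie algebra *)

Section Span.
Variables (M N : zmodType).

Lemma span_prop_map (X : M -> Prop) (Y : N -> Prop) (f : M -> N) x :
  zmod_morphism f -> (forall y, X y -> span_prop Y (f y)) ->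
  span_prop X x -> span_prop Y (f x).
Proof.
move=> fB fX; elim=> {x} [|x /fX //|x y _ fx _ fy]; last by rewrite fB; exact: spanB.
by rewrite -(subrr 0) fB subrr; exact: span0.
Qed.

Lemma span_propN (X : M -> Prop) x : span_prop X x -> span_prop X (- x).
Proof. by move=> Xx; rewrite -sub0r; apply: spanB => //; exact: span0. Qed.

Lemma span_propW (X Y : M -> Prop) x :
  (forall y, X y -> Y y) -> span_prop X x -> span_prop Y x.
Proof.
move=> XY; elim=> {x} [|x /XY|x y _ fx _ fy]; [exact: span0|exact: span_gen|exact: spanB].
Qed.

End Span.

Section LieWords.
Variable A : eqType.
Implicit Types (x y z : free_lie A) (t : lterm A) (psi : seq A -> int) (w s u v : seq A).

Local Notation gen a := (\pi_(free_lie A) (Lgen a)).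
Local Notation brk := (@flie_brk A).

Lemma brk_alt x : brk x x = 0.
Proof. by elim/quotW: x => x; rewrite flie_brkE; exact/lie_piP/lie_alt. Qed.

Lemma brkDl x y z : brk (x + y) z = brk x z + brk y z.
Proof.
elim/quotW: x => x; elim/quotW: y => y; elim/quotW: z => z.
rewrite -[X in brk X _]/(flie_add _ _) -[RHS]/(flie_add _ _) (flie_addE x y).
by rewrite (flie_brkE _ z) (flie_brkE x) (flie_brkE y) flie_addE; exact/lie_piP/lie_brkDl.
Qed.

Lemma brkDr x y z : brk x (y + z) = brk x y + brk x z.
Proof.
elim/quotW: x => x; elim/quotW: y => y; elim/quotW: z => z.
rewrite -[X in brk _ X]/(flie_add _ _) -[RHS]/(flie_add _ _) (flie_addE y z).
by rewrite (flie_brkE x (Ladd _ _)) (flie_brkE x y) (flie_brkE x z) flie_addE; exact/lie_piP/lie_brkDr.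
Qed.

Lemma brkBl z : zmod_morphism (brk^~ z).
Proof. by move=> x y; apply/eqP; rewrite eq_sym subr_eq -brkDl subrK. Qed.

Lemma brkBr z : zmod_morphism (brk z).
Proof. by move=> x y; apply/eqP; rewrite eq_sym subr_eq -brkDr subrK. Qed.

Lemma brkC x y : brk x y = - brk y x.
Proof.
have := brk_alt (x + y); rewrite brkDl !brkDr !brk_alt add0r addr0.
by move/eqP; rewrite addr_eq0 => /eqP.
Qed.

Lemma brkNr x y : brk x (- y) = - brk x y.
Proof. by rewrite -sub0r brkBr -{1}(subrr 0) brkBr subrr sub0r. Qed.

Lemma brk_jacobi x y z : brk x (brk y z) + (brk y (brk z x) + brk z (brk x y)) = 0.
Proof.
elim/quotW: x => x; elim/quotW: y => y; elim/quotW: z => z.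
rewrite -[LHS]/(flie_add _ (flie_add _ _)).
rewrite (flie_brkE y z) (flie_brkE z x) (flie_brkE x y).
rewrite (flie_brkE x) (flie_brkE y) (flie_brkE z).
by rewrite (flie_addE (Lbrk y _)) flie_addE; exact/lie_piP/lie_jacobi.
Qed.

(** The Jacobi identity as a rewriting rule: it moves the bracketing to the left. *)
Lemma brk_brk x y z : brk x (brk y z) = brk (brk x y) z - brk (brk x z) y.
Proof.
have -> : brk (brk x z) y = brk y (brk z x) by rewrite (brkC _ y) (brkC x) brkNr opprK.
by apply/eqP; rewrite (brkC (brk x y)) -subr_eq0 opprB opprK brk_jacobi.
Qed.

(** [word_op t psi s] is the sum of [c * psi (s ++ w)] over the terms [c w] of the
    expansion of [t] in the free associative algebra. Since brackets become
    commutators of operators, the axioms of Lie algebras hold at once, and the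
    associative algebra itself need not be constructed. *)
Fixpoint word_op t psi s : int :=
  match t with
  | Lgen a => psi (rcons s a)
  | Lzero => 0
  | Ladd x y => word_op x psi s + word_op y psi s
  | Lopp x => - word_op x psi s
  | Lbrk x y => word_op x (word_op y psi) s - word_op y (word_op x psi) s
  end.

Lemma eq_word_op t f g : f =1 g -> word_op t f =1 word_op t g.
Proof.
elim: t f g => //= [a|x IHx y IHy|x IHx|x IHx y IHy] f g fg s.
- exact: fg.
- by rewrite (IHx _ _ fg) (IHy _ _ fg).
- by rewrite (IHx _ _ fg).
- by rewrite (IHx _ _ (IHy _ _ fg)) (IHy _ _ (IHx _ _ fg)).
Qed.

Lemma word_op_lin t (a : int) f g s :
  word_op t (fun r => a * f r + g r) s = a * word_op t f s + word_op t g s.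
Proof.
elim: t f g s => //= [|x IHx y IHy|x IHx|x IHx y IHy] f g s.
- by rewrite mulr0 addr0.
- by rewrite IHx IHy; ring.
- by rewrite IHx; ring.
rewrite (eq_word_op _ (IHy f g)) (eq_word_op y (IHx f g)) IHx IHy; ring.
Qed.

Lemma word_opD t f g s :
  word_op t (fun r => f r + g r) s = word_op t f s + word_op t g s.
Proof. by rewrite -[word_op t f s]mul1r -word_op_lin; apply: eq_word_op => r; rewrite mul1r. Qed.

Lemma word_opB t f g s :
  word_op t (fun r => f r - g r) s = word_op t f s - word_op t g s.
Proof.
by rewrite addrC -mulN1r -word_op_lin; apply: eq_word_op => r; rewrite mulN1r addrC.
Qed.

Lemma word_op_scale t (a : int) f s : word_op t (fun r => a * f r) s = a * word_op t f s.
Proof.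
have word_op0 : word_op t (fun=> 0) s = 0.
  by rewrite -[RHS](subrr (word_op t (fun=> 0) s)) -word_opB; apply: eq_word_op.
rewrite -[RHS]addr0 -[X in _ + X]word_op0 -word_op_lin.
by apply: eq_word_op => r; rewrite addr0.
Qed.

Lemma word_op_eq t t' : lie_eq t t' -> word_op t = word_op t'.
Proof.
elim=> {t t'} //=; try by move=> *; apply/funext => psi; apply/funext => s /=; ring.
- by move=> x y z _ -> _ ->.
- by move=> x x' y y' _ -> _ ->.
- by move=> x x' _ ->.
- by move=> x x' y y' _ -> _ ->.
- by move=> x y z; apply/funext => f; apply/funext => s /=; rewrite word_opD; ring.
- by move=> x y z; apply/funext => f; apply/funext => s /=; rewrite word_opD; ring.
- by move=> x y z; apply/funext => f; apply/funext => s /=; rewrite !word_opB; ring.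
Qed.

Definition lie_op x := word_op (repr x).

Lemma lie_op_pi t : lie_op (\pi t) = word_op t.
Proof. exact: word_op_eq (lie_reprP t). Qed.

Lemma lie_opB x y f s : lie_op (x - y) f s = lie_op x f s - lie_op y f s.
Proof.
elim/quotW: x => x; elim/quotW: y => y.
by rewrite -[_ - _]/(flie_add _ (flie_opp _)) flie_oppE flie_addE !lie_op_pi.
Qed.

Lemma lie_op_brk x y f s : lie_op (brk x y) f s = lie_op x (lie_op y f) s - lie_op y (lie_op x f) s.
Proof. by rewrite /flie_brk lie_op_pi. Qed.

Lemma word_op_cons t a f s : word_op t f (a :: s) = word_op t (fun r => f (a :: r)) s.
Proof.
elim: t f s => //= [x IHx y IHy|x IHx|x IHx y IHy] f s; rewrite ?IHx ?IHy //.
by congr (_ - _); apply: eq_word_op => r; rewrite ?IHx ?IHy.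
Qed.

(** The coefficient of the word [w] in the expansion of [x] in the free associative
    algebra. *)
Definition wcoef x w : int := lie_op x (fun s => (s == w)%:R) [::].

Lemma wcoefB x y w : wcoef (x - y) w = wcoef x w - wcoef y w.
Proof. exact: lie_opB. Qed.

Lemma wcoef0 w : wcoef 0 w = 0.
Proof. by rewrite -(subrr 0) wcoefB subrr. Qed.

Lemma wcoefN x w : wcoef (- x) w = - wcoef x w.
Proof. by rewrite -sub0r wcoefB wcoef0 sub0r. Qed.

Lemma wcoefD x y w : wcoef (x + y) w = wcoef x w + wcoef y w.
Proof. by rewrite -{1}[y]opprK wcoefB wcoefN opprK. Qed.

Lemma wcoefMz x (k : int) w : wcoef (x *~ k) w = k * wcoef x w.
Proof.
have wcoefMn n : wcoef (x *+ n) w = wcoef x w *+ n.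
  by elim: n => [|n IHn]; rewrite ?wcoef0 // !mulrS wcoefD IHn.
case: k => n; first by rewrite -pmulrn wcoefMn -mulr_natl natz.
by rewrite NegzE mulrNz -pmulrn wcoefN wcoefMn mulNr -mulr_natl natz.
Qed.

Lemma wcoef_gen a w : wcoef (gen a) w = ([:: a] == w)%:R.
Proof. by rewrite /wcoef lie_op_pi. Qed.

(** In the expansion of a bracket by a letter, the letter comes last or first. *)
Lemma wcoef_brk_gen x b c m m' d : c :: m = rcons m' d ->
  wcoef (brk x (gen b)) (c :: m) = (d == b)%:R * wcoef x m' - (c == b)%:R * wcoef x m.
Proof.
move=> def_w; rewrite /wcoef lie_op_brk !lie_op_pi /= [in X in X - _]def_w; congr (_ - _).
  rewrite -word_op_scale; apply: eq_word_op => s.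
  by rewrite /= eqseq_rcons andbC [b == d]eq_sym -mulnb natrM.
rewrite /lie_op word_op_cons -word_op_scale; apply: eq_word_op => s.
by rewrite eqseq_cons [b == c]eq_sym -mulnb natrM.
Qed.

Definition left_normed x v : free_lie A := foldl (fun y b => brk y (gen b)) x v.

(** The only word of the expansion that starts with [a] is the one in which every
    letter was added on the right. Hence these brackets are linearly
    independent. *)
Lemma wcoef_left_normed a v w : uniq (a :: v) -> wcoef (left_normed (gen a) v) (a :: w) = (w == v)%:R.
Proof.
elim/last_ind: v w => [|v b IHv] w.
  by rewrite /left_normed /= wcoef_gen eqseq_cons eqxx eq_sym.
rewrite /= mem_rcons rcons_uniq inE negb_or -andbA => /and4P[ne_ab av bv Uv].
rewrite /left_normed foldl_rcons -/(left_normed _ v); case: (lastP w) => [|w' d].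
  rewrite (@wcoef_brk_gen _ _ a [::] [::] a) // (negPf ne_ab) !mul0r subr0.
  by case: v {IHv av bv Uv}.
rewrite (@wcoef_brk_gen _ _ _ _ (a :: w') d) // (negPf ne_ab) mul0r subr0 IHv ?eqseq_rcons /= ?av //.
by rewrite -natrM mulnb andbC.
Qed.

(** Induction on [q] with [brk_brk], which replaces a bracket by a monomial with
    successive brackets by its letters. *)
Lemma brk_mon_span (q : lie_monomial A) x :
  span_prop (fun y => exists2 v, perm_eq v (mon_gens q) & y = left_normed x v) (brk x (mon_val q)).
Proof.
elim: q x => [a|p IHp q IHq] x /=; first by apply: span_gen; exists [:: a].
rewrite brk_brk; apply: spanB.
  apply: span_prop_map (brkBl _) _ (IHp x) => _ [v pv ->].
  apply: span_propW (IHq _) => _ [u qu ->]; exists (v ++ u); first exact: perm_cat.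
  by rewrite /left_normed foldl_cat.
apply: span_prop_map (brkBl _) _ (IHq x) => _ [v qv ->].
apply: span_propW (IHp _) => _ [u pu ->]; exists (v ++ u).
  by rewrite perm_catC; exact: perm_cat.
by rewrite /left_normed foldl_cat.
Qed.

(** The factor that contains [a] can be put on the left by antisymmetry; the other
    factor is then absorbed by [brk_mon_span]. *)
Lemma mon_span (m : lie_monomial A) a : a \in mon_gens m ->
  span_prop (fun y => exists2 v, perm_eq (a :: v) (mon_gens m) & y = left_normed (gen a) v) (mon_val m).
Proof.
elim: m => [b|p IHp q IHq] /=.
  by rewrite inE => /eqP->; apply: span_gen; exists [::].
rewrite mem_cat => /orP[/IHp sp|/IHq sq].
  apply: span_prop_map (brkBl _) _ sp => _ [v pv ->].
  apply: span_propW (brk_mon_span _ _) => _ [u qu ->]; exists (v ++ u).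
    by rewrite -cat_cons perm_cat.
  by rewrite /left_normed foldl_cat.
rewrite brkC; apply: span_propN.
apply: span_prop_map (brkBl _) _ sq => _ [v pv ->].
apply: span_propW (brk_mon_span _ _) => _ [u qu ->]; exists (v ++ u).
  by rewrite -cat_cons perm_sym perm_catC perm_sym perm_cat.
by rewrite /left_normed foldl_cat.
Qed.

End LieWords.

Section LieAction.
Variables (gT : finGroupType) (A : finType) (to : lact gT A).
Local Notation gen a := (\pi_(free_lie A) (Lgen a)).

Lemma word_op_map (f : A -> A) t psi s :
  word_op (lmap f t) psi (map f s) = word_op t (fun r => psi (map f r)) s.
Proof.
elim: t psi s => //= [a|x IHx y IHy|x IHx|x IHx y IHy] psi s; rewrite ?IHx ?IHy ?map_rcons //.
by congr (_ - _); apply: eq_word_op => r; rewrite ?IHx ?IHy.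
Qed.

Lemma wcoef_act g (x : free_lie A) w : wcoef (flie_op to g x) w = wcoef x (map (to g^-1%g) w).
Proof.
rewrite /wcoef /flie_op lie_op_pi -[[::] in LHS]/(map (to g) [::]) word_op_map.
apply: eq_word_op => s; congr (nat_of_bool _)%:R.
apply/eqP/eqP => [<-|->]; rewrite -map_comp map_id_in // => a _ /=; [exact: lopK|exact: lopVK].
Qed.

Variable a0 : A.

Definition tails : seq (seq A) := permutations (rem a0 (enum A)).

Lemma mem_tails v : (v \in tails) = perm_eq (a0 :: v) (enum A).
Proof.
rewrite mem_permutations; have a0A := mem_enum A a0.
by rewrite (permPr (perm_to_rem a0A)) perm_cons.
Qed.

(** The left-normed brackets that start with [a0] form a basis, whose dual basis
    consists of the coefficients of the words that start with [a0]. *)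
Lemma Lie_expand (x : Lie to) :
  subz_val x = \sum_(v <- tails) left_normed (gen a0) v *~ wcoef (subz_val x) (a0 :: v).
Proof.
case: x => x /= /asboolP; elim=> {x} [|_ [m m1 ->]|x y _ {1}-> _ {1}->].
- by rewrite big1 // => v _; rewrite wcoef0 mulr0z.
- have pm : perm_eq (mon_gens m) (enum A).
    by apply/allP => a _ /=; rewrite m1 count_uniq_mem ?enum_uniq // mem_enum.
  have a0m : a0 \in mon_gens m by rewrite (perm_mem pm) mem_enum.
  elim: (mon_span a0m) => [|_ [v pv ->]|x y _ {1}-> _ {1}->].
  + by rewrite big1 // => v _; rewrite wcoef0 mulr0z.
  + have vT : v \in tails by rewrite mem_tails (perm_trans pv pm).
    have Uv : uniq (a0 :: v) by rewrite (perm_uniq (perm_trans pv pm)) enum_uniq.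
    rewrite (bigD1_seq v) ?permutations_uniq //= wcoef_left_normed // eqxx mulr1z big1 ?addr0 // => u ne_uv.
    by rewrite wcoef_left_normed // (negPf ne_uv) mulr0z.
  + by rewrite -sumrB; apply: eq_bigr => v _; rewrite wcoefB mulrzBr.
by rewrite -sumrB; apply: eq_bigr => v _; rewrite wcoefB mulrzBr.
Qed.

Lemma left_normed_Lie v : v \in tails ->
  (left_normed (gen a0) v : free_lie_gmodule to) \in Defs.span (@multilinear _ _ to).
Proof.
rewrite mem_tails => pv; apply/asboolP/span_gen.
have [m gm vm] : exists2 m, mon_gens m = a0 :: v & mon_val m = left_normed (gen a0) v.
  elim/last_ind: {pv}v => [|v b [m gm vm]]; first by exists (Mgen a0).
  exists (Mbrk m (Mgen b)); first by rewrite /= gm cats1.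
  by rewrite /left_normed foldl_rcons -/(left_normed _ v) -vm.
exists m => // a; by rewrite gm (seq.permP pv) count_uniq_mem ?enum_uniq // mem_enum.
Qed.

End LieAction.

(** * Clades of a tree, and trees with one inner edge *)

Section Downward.
Variable T : tree.
Implicit Types v w u : 'I_(nvert T).

Definition below : rel 'I_(nvert T) := connect [rel v w | out v == Some w].

Lemma below_step v w : out v = Some w -> below v w.
Proof. by move=> vw; apply: connect1; apply/eqP. Qed.

Lemma below_out v w : below v w -> v = w \/ exists2 u, out v = Some u & below u w.
Proof.
case/connectP => -[|u p] /=; first by move=> _ ->; left.
by case/andP=> /eqP vu pth def_w; right; exists u => //; apply/connectP; exists p.
Qed.

Lemma below_acyclic v w : out v = Some w -> below w v -> False.
Proof.
elim/down_ind: v w => v IH w vw /below_out[def_w|[u wu uv]].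
  by apply: (IH w vw w); rewrite ?[in X in out X]def_w // /below connect0.
apply: (IH w vw u wu); apply: connect_trans uv (below_step vw).
Qed.

Lemma below_total u v w : below u v -> below u w -> below v w || below w v.
Proof.
elim/down_ind: u => u IH uv uw.
have [<-|[x ux xv]] := below_out uv; first by rewrite uw.
have [<-|[y uy yw]] := below_out uw; first by rewrite uv orbT.
by apply: (IH x) => //; move: uy; rewrite ux => -[->].
Qed.

(** Induction from the leaves to the root, on the number of vertices above. *)
Lemma up_ind (P : 'I_(nvert T) -> Prop) :
  (forall v, (forall w, out w = Some v -> P w) -> P v) -> forall v, P v.
Proof.
move=> IH v; have [k] := ubnP #|[set w | below w v]|; elim: k v => // k IHk v lt_k.
apply: IH => w wv; apply: IHk; rewrite ltnS in lt_k; apply: leq_trans lt_k; apply: proper_card.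
apply/properP; split.
  apply/subsetP => x; rewrite !inE => xw; exact: connect_trans xw (below_step wv).
by exists v; rewrite !inE /below ?connect0 //; apply/negP => vw; exact: below_acyclic wv vw.
Qed.

End Downward.

Section Clades.
Variables (A : finType) (S : atree A).
Implicit Types v w u : 'I_(nvert S).

Definition clade v : {set A} := [set a | below (leaf S a) v].

Lemma clade_below v w : below v w -> clade v \subset clade w.
Proof. by move=> vw; apply/subsetP => a; rewrite !inE => av; exact: connect_trans av vw. Qed.

Lemma clade_compat v w : compat (clade v) (clade w).
Proof.
rewrite /compat; case dis: [disjoint _ & _]; first by rewrite !orbT.
move/negbT: dis; rewrite -setI_eq0 => /set0Pn[a]; rewrite !inE => /andP[av aw].
by case/orP: (below_total av aw) => /clade_below->; rewrite ?orbT.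
Qed.

Hypothesis Sred : Defs.reduced S.

Lemma arity_gt1 v : (1 < #|[pred a | leaf S a == v]| + #|[pred w | out w == Some v]|)%N.
Proof. by have /reducedP/(_ v) := Sred; rewrite arity_leaf. Qed.

(** Above each vertex there is a leaf, since no vertex is nullary. *)
Lemma clade_neq0 v : clade v != set0.
Proof.
elim/up_ind: v => v IH; apply/set0Pn; have := arity_gt1 v.
case: (pickP [pred a | leaf S a == v]) => [a /eqP av|no_leaf] lt1.
  by exists a; rewrite inE av /below connect0.
case: (pickP [pred w | out w == Some v]) => [w /eqP wv|no_child].
  have /set0Pn[a aw] := IH w wv; exists a.
  exact: subsetP (clade_below (below_step wv)) a aw.
by rewrite !eq_card0 in lt1.
Qed.

(** Besides the edge leaving [v], another edge comes into [w], and the leaves above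
    that edge are not above [v]. *)
Lemma clade_proper v w : out v = Some w -> clade v \proper clade w.
Proof.
move=> vw; rewrite properE clade_below ?below_step //=; apply/negP => /subsetP sub_wv.
have := arity_gt1 w; case: (pickP [pred a | leaf S a == w]) => [a /eqP aw _|no_leaf].
  have := sub_wv a; rewrite !inE aw /below connect0 => /(_ isT).
  exact: below_acyclic vw.
rewrite [X in (_ < X + _)%N]eq_card0 // add0n => /card_gt1P[x [y []]].
rewrite !inE => /eqP xw /eqP yw ne_xy.
have [z zw ne_zv] : exists2 z, out z = Some w & z != v.
  by have [def_x|] := eqVneq x v; [exists y => //; rewrite -def_x eq_sym | exists x].
have /set0Pn[a az] := clade_neq0 z.
have av : a \in clade v by apply: sub_wv; exact: subsetP (clade_below (below_step zw)) a az.
move: az av; rewrite !inE => az av; case/orP: (below_total az av) => /below_out[def_z|[u]].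
- by rewrite def_z eqxx in ne_zv.
- by rewrite zw => -[<-]; exact: below_acyclic vw.
- by rewrite def_z eqxx in ne_zv.
- by rewrite vw => -[<-]; exact: below_acyclic zw.
Qed.

Lemma clade_gt1 v : (1 < #|clade v|)%N.
Proof.
case: (pickP [pred w | out w == Some v]) => [w /eqP wv|no_child].
  apply: leq_ltn_trans (proper_card (clade_proper wv)); rewrite card_gt0; exact: clade_neq0.
have := arity_gt1 v; rewrite [X in (_ < _ + X)%N]eq_card0 // addn0 => lt1.
apply: leq_trans lt1 _; apply: subset_leq_card; apply/subsetP => a.
by rewrite !inE => /eqP->; exact: connect0.
Qed.

Lemma clade_lt v : v \in inner S -> (#|clade v| < #|A|)%N.
Proof.
rewrite inE; case def_w: (out v) => [w|] // _.
exact: leq_trans (proper_card (clade_proper def_w)) (max_card _).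
Qed.

(** Count the edges by their lower ends: each vertex has at least two. *)
Lemma card_inner : (#|inner S| <= #|A| - 2)%N.
Proof.
have szA : #|A| = nleaf S by rewrite (bij_eq_card (lab_bij S)) card_ord.
have sum_ar : (\sum_v arity (@out S) (@att S) v = #|A| + #|inner S|)%N.
  rewrite (eq_bigr _ (fun v _ => arityE _ _ v)) big_split /=; congr addn.
    rewrite exchange_big /= szA (eq_bigr (fun=> 1%N)) ?sum1_card ?card_ord // => l _.
    by rewrite (bigD1 (att l)) //= eqxx big1 // => v /negPf; rewrite eq_sym => ->.
  rewrite exchange_big /= -sum1_card [RHS]big_mkcond; apply: eq_bigr => w _; rewrite inE.
  case: (out w) => [u|] /=; last by rewrite big1.
  rewrite (bigD1 u) //= eqxx big1 // => v /negPf ne_vu.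
  by rewrite (inj_eq Some_inj) eq_sym ne_vu.
have : (\sum_(v < nvert S) 2 <= \sum_v arity (@out S) (@att S) v)%N.
  by apply: leq_sum => v _; have /reducedP := Sred; apply.
rewrite sum_ar sum_nat_const card_ord.
have : (#|inner S| < nvert S)%N.
  rewrite -[X in (_ < X)%N]card_ord; apply: proper_card; apply/properP; split; first exact: subset_predT.
  by exists (Defs.root S) => //; rewrite inE out_root.
by lia.
Qed.

End Clades.

Section OneEdge.
Variables (A : finType) (a0 : A).
Implicit Types C D : {set A}.

Definition edge_out (v : 'I_2) : option 'I_2 := if v == ord0 then Some ord_max else None.

(** The empty set is replaced by the whole of [A] in order that no vertex be nullary. *)
Definition edge_att C (l : 'I_#|A|) : 'I_2 :=
  if (C == set0) || (enum_val l \in C) then ord0 else ord_max.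

Lemma edge_rooted v : connect [rel v w | edge_out v == Some w] v ord_max.
Proof.
case: (unliftP ord_max v) => [j ->|->]; last exact: connect0.
by apply: connect1; rewrite /= /edge_out ord1.
Qed.

Lemma edge_no_nullary C v : arity edge_out (edge_att C) v != 0%N.
Proof.
rewrite /arity addn_eq0 negb_and -!lt0n; case: (unliftP ord_max v) => [j ->|->].
  have [a aC] : exists a, (C == set0) || (a \in C).
    by have [->|/set0Pn[a aC]] := eqVneq C set0; [exists a0 | exists a; rewrite aC].
  apply/orP; left; apply/card_gt0P; exists (enum_rank a).
  by rewrite inE /edge_att enum_rankK aC ord1; apply/eqP/val_inj.
by apply/orP; right; apply/card_gt0P; exists ord0; rewrite inE.
Qed.

Definition edge_tree C : atree A :=
  @ATree A (Tree (erefl : edge_out ord_max = None) edge_rooted (edge_no_nullary C)) enum_rank (@enum_rank_bij A).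

(** The vertex of the complex given by the tree whose inner edge has the leaves [C]
    above it. *)
Definition tau C : atree_class A := \pi_(atree_class A) (edge_tree C).

Lemma leaf_edge C a : C != set0 -> leaf (edge_tree C) a = if a \in C then ord0 else ord_max.
Proof. by move=> /negPf C0; rewrite /leaf /= /edge_att enum_rankK C0. Qed.

Lemma edge_treeP C (T : atree A) (e r : 'I_(nvert T)) : C != set0 ->
  (forall v, v = e \/ v = r) -> e != r -> out e = Some r -> out r = None ->
  (forall a, leaf T a = if a \in C then e else r) -> \pi_(atree_class A) T = tau C.
Proof.
move=> C0 vP ne_er oute outr leafT; apply/atree_piP/atree_iso_sym.
exists (fun v : 'I_2 => if v == ord0 then e else r); split=> [|v|a].
- exists (fun v => if v == e then ord0 else ord_max) => v.
    have [->|ne_v0] := eqVneq v ord0; first by rewrite eqxx.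
    rewrite [r == e]eq_sym (negPf ne_er).
    by case: (unliftP ord_max v) ne_v0 => [j|] -> //; rewrite ord1 => /eqP[]; apply: val_inj.
  by case: (vP v) => ->; [rewrite !eqxx | rewrite [r == e]eq_sym (negPf ne_er)].
- by rewrite /= /edge_out; case: eqP; rewrite ?oute ?outr.
- by rewrite leafT leaf_edge //; case: ifP.
Qed.

Lemma tau_inj C D : C != set0 -> D != set0 -> tau C = tau D -> C = D.
Proof.
move=> C0 D0 /atree_piP[h [bh hout hleaf]].
have h1 : h ord_max = ord_max.
  have := hout ord_max; rewrite /= /edge_out /=; case: eqP => // /eqP ne_h _.
  by case: (unliftP ord_max (h ord_max)) ne_h => [j ->|-> //]; rewrite ord1.
apply/setP => a; have := hleaf a; rewrite !leaf_edge //.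
case: (a \in C); case: (a \in D) => //; rewrite ?h1 //.
by move=> e1; have := bij_inj bh (etrans h1 e1).
Qed.

(** Collapsing all inner edges but [e] glues the vertices above [e] to its upper
    end, and all others to the root. *)
Lemma collapse_tau (S T : atree A) (e : 'I_(nvert S)) : clade e != set0 ->
  e \in inner S -> collapse (inner S :\ e) T -> \pi_(atree_class A) T = tau (clade e).
Proof.
move=> e0 eS [c [c_inj c_surj cE cN cleaf]].
have rootN : Defs.root S \in ~: (inner S :\ e) by rewrite !inE out_root andbF.
have eN : e \in ~: (inner S :\ e) by rewrite !inE eqxx.
have ne_er : e != Defs.root S by apply: contraTneq eS => ->; rewrite inE out_root.
have cP v : c v = if below v e then c e else c (Defs.root S).
  elim/down_ind: v => v IH; have [vE|] := boolP (v \in inner S :\ e).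
    have := cE v vE; move: vE; rewrite !inE => /andP[ne_ve].
    case def_u: (out v) => [u|] //= _ [<-]; rewrite IH //; congr (if _ then _ else _).
    apply/idP/idP => [|/below_out[def_v|[x]]]; first exact: connect_trans (below_step def_u).
      by rewrite def_v eqxx in ne_ve.
    by rewrite def_u => -[->].
  rewrite !inE negb_and !negbK => /orP[/eqP->|/eqP outv]; first by rewrite /below connect0.
  have -> : v = Defs.root S.
    by have [//|[u]] := below_out (rooted v : below v _); rewrite outv.
  case: ifP => // /below_out[def_e|[x]]; last by rewrite out_root.
  by rewrite def_e eqxx in ne_er.
apply: (@edge_treeP _ _ (c e) (c (Defs.root S))) => //.
- by move=> v; have [w _ <-] := c_surj v; rewrite cP; case: ifP; [left|right].
- by apply: contra_neq ne_er; exact: c_inj.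
- move: eS; rewrite cN // inE; case def_u: (out e) => [u|] //= _; rewrite cP.
  by case: ifP => // ue; case: (below_acyclic def_u ue).
- by rewrite cN // out_root.
- by move=> a; rewrite cleaf cP inE.
Qed.

Definition cluster C := (1 < #|C| < #|A|)%N.

Lemma cluster_neq0 C : cluster C -> C != set0.
Proof. by case/andP=> C1 _; rewrite -card_gt0 ltnW. Qed.

(** The vertices of the simplex of [S] are its clades, in the guise of trees with one
    inner edge. *)
Lemma simplex_clades s : tree_simplex s ->
  exists2 S : atree A, Defs.reduced S &
    forall x, x \in s <-> exists2 e, e \in inner S & x = tau (clade e).
Proof.
case=> S [Sred S0 Ss]; exists S => // x; split=> [/Ss[e [T [eS eT ->]]]|[e eS ->]].
  by exists e => //; apply: collapse_tau => //; exact: clade_neq0.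
have [T eT] : exists T, collapse (inner S :\ e) T by apply: collapse_exists; exact: subsetDl.
by apply/Ss; exists e, T; split=> //; rewrite (collapse_tau _ eS eT) //; exact: clade_neq0.
Qed.

End OneEdge.

(** * Trees from laminar families *)

Section Hierarchy.
Variables (A : finType) (F : {set {set A}}).
Hypotheses (A1 : (1 < #|A|)%N) (Fcl : {in F, forall C, cluster C}) (Flam : {in F &, forall C D, compat C D}).
Implicit Types C D : {set A}.

(** The vertices of the tree of the family [F]. The leaf [a] will be attached to the
    least of these sets that contains it, and each set to the next larger one. *)
Definition blocks := setT |: F.

Lemma setT_blocks : setT \in blocks. Proof. exact: setU11. Qed.

Lemma blocks_gt1 C : C \in blocks -> (1 < #|C|)%N.
Proof. by rewrite in_setU1 => /predU1P[->|/Fcl/andP[C1 _]]; rewrite ?cardsT. Qed.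

Lemma blocks_nested C D a : C \in blocks -> D \in blocks -> a \in C -> a \in D ->
  (C \subset D) || (D \subset C).
Proof.
rewrite !in_setU1 => /predU1P[->|CF] /predU1P[->|DF]; rewrite ?subsetT ?orbT // => aC aD.
case/or3P: (Flam CF DF) => [->|->|/pred0P/(_ a)] //; first by rewrite orbT.
by rewrite /= aC aD.
Qed.

Definition parent C : {set A} :=
  [arg min_(D < setT | (D \in blocks) && (C \proper D)) #|D|].

Definition least a : {set A} := [arg min_(D < setT | (D \in blocks) && (a \in D)) #|D|].

Lemma leastP a : [/\ least a \in blocks, a \in least a &
  forall D, D \in blocks -> a \in D -> least a \subset D].
Proof.
rewrite /least; case: arg_minnP => [|D /andP[DB aD] Dmin]; first by rewrite setT_blocks inE.
split=> // E EB aE; have [//|ED] := orP (blocks_nested DB EB aD aE).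
have /eqP-> // : E == D by rewrite eqEcard ED Dmin ?EB.
Qed.

Lemma parentP C : C \in blocks -> C != setT -> [/\ parent C \in blocks, C \proper parent C &
  forall D, D \in blocks -> C \proper D -> parent C \subset D].
Proof.
move=> CB CT; rewrite /parent; case: arg_minnP => [|D /andP[DB CD] Dmin].
  by rewrite setT_blocks properT.
split=> // E EB CE; have /set0Pn[a aC] : C != set0 by rewrite -card_gt0 ltnW // blocks_gt1.
have aD := subsetP (proper_sub CD) a aC; have aE := subsetP (proper_sub CE) a aC.
have [//|ED] := orP (blocks_nested DB EB aD aE).
have /eqP-> // : E == D by rewrite eqEcard ED Dmin ?EB.
Qed.

Notation N := #|blocks|.

Definition block (v : 'I_N) : {set A} := enum_val v.
Definition vert C : 'I_N := enum_rank_in setT_blocks C.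

Lemma vertK C : C \in blocks -> block (vert C) = C.
Proof. exact: enum_rankK_in. Qed.

Lemma block_inj : injective block. Proof. exact: enum_val_inj. Qed.

Lemma blockP v : block v \in blocks. Proof. exact: enum_valP. Qed.

Definition hier_out (v : 'I_N) : option 'I_N :=
  if block v == setT then None else Some (vert (parent (block v))).

Definition hier_att (l : 'I_#|A|) : 'I_N := vert (least (enum_val l)).

Local Notation down := (connect [rel v w | hier_out v == Some w]).

Lemma hier_outP v w : hier_out v = Some w ->
  [/\ block v \proper block w, block v != setT &
      forall D, D \in blocks -> block v \proper D -> block w \subset D].
Proof.
rewrite /hier_out; case: eqP => // /eqP vT [<-].
by have [pB pP pmin] := parentP (blockP v) vT; rewrite vertK.
Qed.

(** The sets of the family that contain a given one form a chain, which is climbed by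
    taking parents. *)
Lemma hier_down v w : down v w = (block v \subset block w).
Proof.
apply/idP/idP => [/connectP[p]|].
  elim: p v => [|u p IHp] v /=; first by move=> _ ->.
  case/andP=> /eqP/hier_outP[vu _ _] pth lst; exact: subset_trans (proper_sub vu) (IHp u pth lst).
have [k] := ubnP (#|A| - #|block v|); elim: k v => // k IHk v lt_k vw.
have [/block_inj->|ne_vw] := eqVneq (block v) (block w); first exact: connect0.
have pr_vw : block v \proper block w by rewrite properEneq ne_vw.
have vT : block v != setT by apply: contraTneq pr_vw => ->; rewrite properE (subsetT (block w)) andbF.
have out_v : hier_out v = Some (vert (parent (block v))) by rewrite /hier_out (negPf vT).
have [pv _ pmin] := hier_outP out_v.
apply: connect_trans (connect1 _) (IHk (vert (parent (block v))) _ _); first exact/eqP.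
  by have := proper_card pv; have := max_card (block (vert (parent (block v)))); lia.
exact: pmin (blockP w) pr_vw.
Qed.

Lemma hier_rooted v : down v (vert setT).
Proof. by rewrite hier_down vertK ?subsetT // setT_blocks. Qed.

Lemma hier_out_root : hier_out (vert setT) = None.
Proof. by rewrite /hier_out vertK ?eqxx ?setT_blocks. Qed.

(** Consider the last edge of the path that leads from the leaf [a] to [v]. *)
Lemma hier_edge v a : a \in block v ->
  least a = block v \/ exists2 w, a \in block w & hier_out w = Some v.
Proof.
move=> av; have [lB al lmin] := leastP a.
have : down (vert (least a)) v by rewrite hier_down vertK // lmin // blockP.
case/connectP => p; case/lastP: p => [|p x].
  by move=> _ ->; left; rewrite vertK.
rewrite rcons_path last_rcons => /andP[pth /eqP out_x] ->; right.
exists (last (vert (least a)) p) => //.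
have : down (vert (least a)) (last (vert (least a)) p) by apply/connectP; exists p.
by rewrite hier_down vertK // => /subsetP; apply.
Qed.

(** A child of [v] does not contain all of [v], so that an element outside of it gives
    a second edge; if there is no child, then two elements give two leaves. *)
Lemma hier_arity v : (1 < arity hier_out hier_att v)%N.
Proof.
have leafP a : least a = block v -> enum_rank a \in [pred l | hier_att l == v].
  by move=> la; rewrite inE /hier_att enum_rankK la; apply/eqP/block_inj; rewrite vertK ?blockP.
have childP w : hier_out w = Some v -> w \in [pred w | hier_out w == Some v].
  by move=> wv; rewrite inE; apply/eqP.
have /card_gt1P[a [b [av bv ne_ab]]] := blocks_gt1 (blockP v).
rewrite /arity; case: (hier_edge av) => [/leafP la|[w aw wv]].
  case: (hier_edge bv) => [/leafP lb|[w bw /childP wv]].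
    apply: leq_trans (leq_addr _ _); apply/card_gt1P; exists (enum_rank a), (enum_rank b).
    by rewrite la lb (inj_eq enum_rank_inj).
  by rewrite -[2%N]/(1 + 1)%N leq_add //; apply/card_gt0P; [exists (enum_rank a)|exists w].
have [pr_wv _ _] := hier_outP wv; have /properP[_ [c cv cw]] := pr_wv.
case: (hier_edge cv) => [/leafP lc|[u cu uv]].
  by rewrite -[2%N]/(1 + 1)%N leq_add //; apply/card_gt0P; [exists (enum_rank c)|exists w; exact: childP].
apply: leq_trans (leq_addl _ _); apply/card_gt1P; exists u, w; split; try exact: childP.
by apply: contraNneq cw => <-.
Qed.

Lemma hier_no_nullary v : arity hier_out hier_att v != 0%N.
Proof. by rewrite -lt0n ltnW // hier_arity. Qed.

Definition hier : atree A :=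
  @ATree A (Tree hier_out_root hier_rooted hier_no_nullary) enum_rank (@enum_rank_bij A).

Lemma hier_reduced : Defs.reduced hier.
Proof. by apply/reducedP => v; exact: hier_arity. Qed.

Lemma clade_hier (v : 'I_(nvert hier)) : clade v = block v.
Proof.
apply/setP => a; rewrite inE; rewrite /below /leaf /= /hier_att enum_rankK.
rewrite [LHS]hier_down; have [lB al lmin] := leastP a; rewrite vertK //.
by apply/idP/idP => [/subsetP|av]; [apply | rewrite lmin // blockP].
Qed.

Lemma inner_hier (v : 'I_(nvert hier)) : (v \in inner hier) = (block v \in F).
Proof.
rewrite inE /= /hier_out; have := blockP v; rewrite in_setU1.
have [->|_ /= ->] // := eqVneq (block v) setT.
by move=> _; apply/esym/negP => /Fcl/andP[_]; rewrite cardsT ltnn.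
Qed.

Lemma hier_simplex (a0 : A) (s : {fset atree_class A}) : F != set0 ->
  (forall x, x \in s <-> exists2 C, C \in F & x = tau a0 C) -> tree_simplex s.
Proof.
have cl0 (v : 'I_(nvert hier)) : clade v != set0 by apply: clade_neq0; exact: hier_reduced.
have FB C : C \in F -> C \in blocks by move=> CF; rewrite in_setU1 CF orbT.
have vertF C : C \in F -> (vert C : 'I_(nvert hier)) \in inner hier.
  by move=> CF; rewrite inner_hier vertK ?FB.
case/set0Pn=> C0 C0F sP; exists hier; split; first exact: hier_reduced.
  by apply/set0Pn; exists (vert C0); exact: vertF.
move=> x; split=> [/sP[C CF ->]|[e [T [eS eT ->]]]].
  have [T eT] : exists T, collapse (inner hier :\ vert C) T.
    by apply: collapse_exists; exact: subsetDl.
  exists (vert C), T; split=> //; first exact: vertF.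
  by rewrite (@collapse_tau _ a0 hier T (vert C)) ?vertF // clade_hier vertK ?FB.
apply/sP; exists (block e); first by rewrite -inner_hier.
by rewrite (collapse_tau a0 _ eS eT) // clade_hier.
Qed.

End Hierarchy.

Section TreeComplexOfClusters.
Variables (gT : finGroupType) (A : finType) (to : lact gT A) (a0 : A).
Hypothesis A1 : (1 < #|A|)%N.
Local Notation tau := (tau a0).
Local Notation K := (tree_complex to).

Lemma tau_act g (C : {set A}) : C != set0 -> vact K g (tau C) = tau (to g @: C).
Proof.
move=> C0; rewrite /= class_opE.
have im C' a : (a \in to g @: C') = (to g^-1%g a \in C').
  apply/imsetP/idP => [[b bC ->]|aC]; first by rewrite lopK.
  by exists (to g^-1%g a); rewrite // lopVK.
have gC0 : to g @: C != set0.
  have /set0Pn[a aC] := C0; apply/set0Pn; exists (to g a); exact: imset_f.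
apply: (@edge_treeP _ a0 _ (relabel to g (edge_tree a0 C)) ord0 ord_max) => // [v|a].
  by case: (unliftP ord_max v) => [j|] ->; [left; apply: val_inj; rewrite /= ord1 | right].
by rewrite im -(leaf_edge a0 (to g^-1%g a) C0).
Qed.

(** [tau] identifies the complex of trees with that of laminar families of clusters:
    the clades of a tree form such a family, and each one comes from a tree. *)
Lemma tree_simplexP (t : seq {set A}) : t != [::] -> {in t, forall C, cluster C} ->
  tree_simplex [fset x in [seq tau C | C <- t]]%fset <-> laminar t.
Proof.
move=> t0 tcl; split=> [/(simplex_clades a0)[S Sred Ss] C D Ct Dt|tlam].
  have cladeE E : E \in t -> exists e : 'I_(nvert S), E = clade e.
    move=> Et; have /Ss[e eS def_E] : tau E \in [fset x in [seq tau C | C <- t]]%fset.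
      by rewrite inE map_f.
    exists e; apply: tau_inj def_E; last exact: clade_neq0.
    exact: cluster_neq0 (tcl E Et).
  have [e ->] := cladeE C Ct; have [f ->] := cladeE D Dt; exact: clade_compat.
apply: (@hier_simplex _ [set C in t] _ _ _ a0).
- exact: A1.
- by move=> C; rewrite inE => /tcl.
- by move=> C D; rewrite !inE; exact: tlam.
- by case: (t) t0 => // C t' _; apply/set0Pn; exists C; rewrite inE mem_head.
- move=> x; rewrite inE; split=> [/mapP[C Ct ->]|[C Ct ->]]; first by exists C; rewrite ?inE.
  by rewrite map_f //; rewrite inE in Ct.
Qed.

Lemma ordered_simplex_tau (t : seq {set A}) : {in t, forall C, cluster C} ->
  ordered_simplex (K := K) [seq tau C | C <- t] <-> uniq t /\ laminar t.
Proof.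
move=> tcl; have tau_uniq : uniq [seq tau C | C <- t] = uniq t.
  apply: map_inj_in_uniq => C D /tcl C1 /tcl D1; apply: tau_inj; exact: cluster_neq0.
rewrite /ordered_simplex tau_uniq; have [->|t0] := eqVneq t [::]; first by split=> // _; split=> //; left.
split=> [[Ut [/eqP|/tree_simplexP]]|[Ut tlam]].
- by rewrite -size_eq0 size_map size_eq0 (negPf t0).
- by move=> /(_ t0 tcl).
- by split=> //; right; apply/tree_simplexP.
Qed.

Lemma ordered_simplexP (s : seq (vertex K)) : ordered_simplex s ->
  exists2 t, {in t, forall C, cluster C} & s = [seq tau C | C <- t].
Proof.
case=> _ [->|/(simplex_clades a0)[S Sred Ss]]; first by exists [::].
have cladeE x : x \in s -> exists2 C, cluster C & x = tau C.
  move=> xs; have /Ss[e eS ->] : x \in [fset y in s]%fset by rewrite inE.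
  by exists (clade e); rewrite // /cluster clade_gt1 // clade_lt.
elim: (s) cladeE => [|x r IHr] rP; first by exists [::].
have [|t tcl ->] := IHr; first by move=> y yr; apply: rP; rewrite inE yr orbT.
have [C C1 ->] := rP x (mem_head x r); exists (C :: t) => //.
by move=> D; rewrite inE => /predU1P[->|/tcl].
Qed.

Lemma laminar_size (t : seq {set A}) : {in t, forall C, cluster C} -> uniq t -> laminar t ->
  (size t <= #|A| - 2)%N.
Proof.
move=> tcl Ut tlam; have [->|t0] := eqVneq t [::]; first by [].
have /(tree_simplexP t0 tcl)/(simplex_clades a0)[S Sred Ss] := tlam.
apply: leq_trans (card_inner Sred).
rewrite -(card_uniqP Ut).
apply: leq_trans (leq_imset_card (@clade A S) (mem (inner S))).
apply: subset_leq_card; apply/subsetP => C Ct.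
have /Ss[e eS def_C] : tau C \in [fset x in [seq tau C | C <- t]]%fset by rewrite inE map_f.
apply/imsetP; exists e => //; apply: tau_inj def_C; last exact: clade_neq0.
exact: cluster_neq0 (tcl C Ct).
Qed.

End TreeComplexOfClusters.

(** * Combs *)

Section Combs.
Variable A : finType.
Implicit Types (w u v : seq A) (a b c d : A) (C D U : {set A}) (s t : seq {set A}).
Local Notation gen a := (\pi_(free_lie A) (Lgen a)).

(** The clades of the comb whose leaves are [u], the two first ones being farthest
    from the root; the largest clade comes first. *)
Definition prefixes u : seq {set A} :=
  [seq [set x in take k u] | k <- rev (iota 2 (size u - 2))].

Lemma size_prefixes u : size (prefixes u) = (size u - 2)%N.
Proof. by rewrite size_map size_rev size_iota. Qed.

Lemma prefixes_rcons u b : (1 < size u)%N -> prefixes (rcons u b) = [set x in u] :: prefixes u.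
Proof.
move=> u1; rewrite /prefixes size_rcons (_ : ((size u).+1 - 2 = (size u - 2).+1)%N); last by lia.
rewrite -[(_ - 2).+1]addn1 iotaD rev_cat /= subnKC // -cats1 take_size_cat //; congr (_ :: _).
apply/eq_in_map => k; rewrite mem_rev mem_iota => /andP[_ lt_k].
by rewrite takel_cat //; lia.
Qed.

Lemma prefixes_head a v C : C \in prefixes (a :: v) -> a \in C.
Proof.
case/mapP=> k; rewrite mem_rev mem_iota => /andP[k2 _] ->.
by rewrite inE; case: k k2 => //= k _; rewrite mem_head.
Qed.

Lemma prefixesP u C : uniq u -> C \in prefixes u -> C \proper [set x in u] /\ (1 < #|C|)%N.
Proof.
move=> Uu /mapP[k]; rewrite mem_rev mem_iota => /andP[k2 ltk] ->.
have szk : #|[set x in take k u]| = k.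
  by rewrite cardsE (card_uniqP _) ?take_uniq // size_takel //; lia.
split; last by rewrite szk.
rewrite properEcard szk cardsE (card_uniqP Uu); apply/andP; split; last by lia.
by apply/subsetP => x; rewrite !inE; exact: mem_take.
Qed.

Lemma prefixes_uniq u : uniq u -> uniq (prefixes u).
Proof.
move=> Uu; rewrite map_inj_in_uniq ?rev_uniq ?iota_uniq // => i j.
rewrite !mem_rev !mem_iota => /andP[i2 lti] /andP[j2 ltj] /(congr1 (fun C : {set A} => #|C|)).
by rewrite !cardsE !(card_uniqP _) ?take_uniq // !size_takel //; lia.
Qed.

Lemma prefixes_laminar u : laminar (prefixes u).
Proof.
move=> C D /mapP[i _ ->] /mapP[j _ ->]; wlog le_ij : i j / (i <= j)%N => [IH|].
  by case/orP: (leq_total i j) => /IH //; rewrite compatC.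
apply/orP; left; apply/subsetP => x; rewrite !inE -{1}(take_takel u le_ij).
exact: mem_take.
Qed.

(** The largest set of the chain misses exactly one element of [B], which is the last
    letter; the others are obtained by induction on the chain. *)
Lemma chain_word a (B : {set A}) t : a \in B -> (1 < #|B|)%N -> uniq t ->
  {in t, forall C, [/\ C \proper B, (1 < #|C|)%N & a \in C]} -> laminar t ->
  (#|B| - 2 <= size t)%N ->
  exists v, [/\ uniq (a :: v), [set x in a :: v] = B & perm_eq t (prefixes (a :: v))].
Proof.
have [k] := ubnP (size t); elim: k B t => // k IH B t lt_k aB B1 Ut tP tL le_t.
case: (t =P [::]) => [t0|/eqP t0].
  have /cards1P[b def_b] : #|B :\ a| == 1%N by move: B1 le_t; rewrite t0 (cardsD1 a B) aB /=; lia.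
  have defB : B = [set x in [:: a; b]].
    by rewrite -(setD1K aB) def_b; apply/setP => x; rewrite !inE.
  exists [:: b]; rewrite defB t0; split=> //=; rewrite inE andbT.
  have : b \in B :\ a by rewrite def_b set11.
  by rewrite !inE eq_sym => /andP[].
have [C Ct Cmax] : exists2 C, C \in t & forall D, D \in t -> (#|D| <= #|C|)%N.
  case: (t) t0 => // C0 t' _; case: (@arg_maxnP _ C0 (mem (C0 :: t')) (fun C => #|C|) (mem_head _ _)) => C Ct Cmax.
  by exists C.
have [CB C1 aC] := tP C Ct.
have remP D : D \in rem C t -> [/\ D \proper C, (1 < #|D|)%N & a \in D].
  rewrite mem_rem_uniq // !inE => /andP[ne_DC Dt]; have [_ D1 aD] := tP D Dt; split=> //.
  have [] := or3P (tL D C Dt Ct); first by rewrite properEneq ne_DC.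
    by move=> CD; rewrite eq_sym eqEcard CD Cmax in ne_DC.
  by move/pred0P/(_ a); rewrite /= aD aC.
have szt : size (rem C t) = (size t).-1 by rewrite size_rem.
have ltCB := proper_card CB.
have szt0 : (0 < size t)%N by case: (t) t0.
have [|||v [Uv Cv pv]] := IH C (rem C t) _ aC C1 (rem_uniq _ Ut) remP.
- by rewrite szt; lia.
- by move=> D E /mem_rem Dt /mem_rem; exact: tL.
- by rewrite szt; lia.
have szC : #|C| = (size v).+1 by rewrite -Cv cardsE (card_uniqP Uv).
have := perm_size pv; rewrite size_prefixes szt /= => szv.
have /cards1P[b def_b] : #|B :\: C| == 1%N.
  by rewrite cardsDS ?proper_sub //; lia.
have := set11 b; rewrite -def_b inE => /andP[bC bB].
have defB : B = b |: C.
  apply/setP => x; rewrite in_setU -def_b in_setD; case xC: (x \in C); rewrite ?orbF ?orbT //.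
  exact: subsetP (proper_sub CB) x xC.
exists (rcons v b); split.
- by rewrite -[_ && _]/(uniq (rcons (a :: v) b)) rcons_uniq Uv andbT; rewrite -Cv inE in bC.
- by apply/setP => x; rewrite defB -Cv !inE mem_rcons !inE orbCA.
rewrite -rcons_cons prefixes_rcons /=; last by lia.
by rewrite Cv (perm_trans (perm_to_rem Ct)) // perm_cons.
Qed.

Lemma take1_sphere c w psi : (0 < size w)%N ->
  cone (take 1 (c :: w)) (fun s => cone (drop 1 (c :: w)) (fun t => psi (s ++ t))) = cone w psi.
Proof. by move=> w0; rewrite cone1 ?size_takel //= drop0. Qed.

Lemma cone_psign w U t : uniq w -> (1 < size w)%N -> size w = #|U| ->
  cone w (fun s => psign s (U :: t)) =
  ([set x in w] == U)%:R * sphere w (fun s => psign s t).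
Proof.
move=> Uw w1 szw; rewrite coneE // -sphere_scale; apply: eq_sphere => // s [_ _ sP _].
rewrite psign_consl //; apply/negP => /sP[/proper_card + _].
by rewrite cardsE (card_uniqP Uw) szw ltnn.
Qed.

(** Disjoint sets cannot both contain [a]. As the two parts of a word are disjoint,
    only the splittings with a part of size one contribute. *)
Lemma sphere_psign a w c d m1 m2 U t : uniq w -> (2 < size w)%N -> size w = #|U|.+1 ->
  w = c :: m1 -> w = rcons m2 d -> {in U :: t, forall C, a \in C} ->
  sphere w (fun s => psign s (U :: t)) =
  ([set x in m1] == U)%:R * sphere m1 (fun s => psign s t) +
  (-1) ^+ #|U|.-1 * (([set x in m2] == U)%:R * sphere m2 (fun s => psign s t)).
Proof.
move=> Uw w2 szw def1 def2 aU.
have szm1 : size m1 = #|U| by move: szw; rewrite def1 => -[].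
have szm2 : size m2 = #|U| by move: szw; rewrite def2 size_rcons => -[].
have U1 : (1 < #|U|)%N by move: w2; rewrite szw; lia.
have Um1 : uniq m1 by move: Uw; rewrite def1 => /andP[].
have Um2 : uniq m2 by move: Uw; rewrite def2 rcons_uniq => /andP[].
rewrite [LHS]/sphere szw big_nat_recl; last by lia.
rewrite expr0 mul1r; congr (_ + _).
  by rewrite def1 (take1_sphere c (fun s => psign s (U :: t))) ?cone_psign ?szm1 //; lia.
have -> : #|U| = #|U|.-1.+1 by lia.
rewrite big_nat_recr /=; last by lia.
rewrite big1_seq ?add0r.
  congr (_ * _); rewrite -(cone_psign _ Um2) ?szm2 // (_ : #|U|.-1.+1 = size m2); last by lia.
  rewrite def2 -cats1 take_size_cat // drop_size_cat //.
  by congr cone; apply/funext => s; rewrite cone1 // cats0.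
move=> i; rewrite mem_index_iota => /andP[_ /andP[i1 lti]].
have szt : size (take i.+1 w) = i.+1 by rewrite size_takel // szw; lia.
have szd : size (drop i.+1 w) = (#|U| - i)%N by rewrite size_drop szw subSS.
rewrite coneE ?szt //; set W1 := [set x in _]; set W2 := [set x in drop i.+1 w].
rewrite (_ : (fun s => _) = fun _ => 0).
  by have := sphere_scale (take i.+1 w) 0 (fun=> 0); rewrite !mul0r => ->; rewrite mulr0.
apply/funext => s; rewrite coneE ?szd; last by lia.
rewrite (_ : (fun t0 => _) = fun t0 => 0 * psign ((W1 :: s) ++ W2 :: t0) (U :: t)) ?sphere_scale ?mul0r //.
apply/funext => r; rewrite mul0r; apply/eqP/negPn/negP => /psign_perm_eq/perm_mem mem_eq.
have aW1 : a \in W1 by apply: aU; rewrite -mem_eq mem_head.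
have aW2 : a \in W2 by apply: aU; rewrite -mem_eq mem_cat mem_head orbT.
move: Uw; rewrite -(cat_take_drop i.+1 w) cat_uniq => /and3P[_ /hasPn/(_ a) + _].
by rewrite !inE in aW1 aW2; rewrite aW1 aW2 => /(_ isT).
Qed.

(** Both sides obey the same recursion: the last letter of the left-normed bracket is
    the first or the last letter of each word of its expansion, and the splittings
    of the word that contribute on the right detach its first or its last letter.
    The binomial coefficient collects the signs of detaching a letter at the end. *)
Lemma wcoef_comb a v w : uniq (a :: v) -> (0 < size v)%N -> perm_eq w (a :: v) ->
  (-1) ^+ 'C(size v, 2) * wcoef (left_normed (gen a) v) w =
  psign w (a :: v) * sphere w (fun s => psign s (prefixes (a :: v))).
Proof.
elim/last_ind: v w => // v b IHv w; rewrite -rcons_cons => Uvb _ pw.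
have Uw : uniq w by rewrite (perm_uniq pw).
have szw : size w = (size v).+2 by rewrite (perm_size pw) size_rcons.
have [c [m1 def1]] : exists c m1, w = c :: m1 by case: (w) szw => // c m1; exists c, m1.
have [m2 [d def2]] : exists m2 d, w = rcons m2 d.
  by case: (lastP w) szw => // m2 d; exists m2, d.
have wcoefE : wcoef (left_normed (gen a) (rcons v b)) w =
    (d == b)%:R * wcoef (left_normed (gen a) v) m2 - (c == b)%:R * wcoef (left_normed (gen a) v) m1.
  by rewrite /left_normed foldl_rcons -/(left_normed _ v) def1; apply: wcoef_brk_gen; rewrite -def1.
move: Uvb; rewrite rcons_uniq => /andP[bv Uv].
have pm1 : c = b -> perm_eq m1 (a :: v).
  by move=> cb; rewrite -(perm_cons b) -{1}cb -def1 (perm_trans pw) // perm_rcons.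
have pm2 : d = b -> perm_eq m2 (a :: v).
  move=> db; move: pw; rewrite def2 db.
  by rewrite perm_rcons perm_sym perm_rcons perm_cons perm_sym.
have szm1 : size m1 = (size v).+1 by move: szw; rewrite def1 => -[].
have szm2 : size m2 = (size v).+1 by move: szw; rewrite def2 size_rcons => -[].
have psign1 : c = b -> psign w (rcons (a :: v) b) = (-1) ^+ (size v).+1 * psign m1 (a :: v).
  by move=> cb; rewrite def1 cb psign_cons_rcons // szm1.
have psign2 : d = b -> psign w (rcons (a :: v) b) = psign m2 (a :: v).
  by move=> db; rewrite def2 db psign_rcons2.
have [v0|v_gt0] := posnP (size v).
  have {}v0 := size0nil v0; rewrite v0 /= in bv szm1 szm2 wcoefE psign1 psign2 pw *.
  have [e def_m1] : exists e, m1 = [:: e] by case: (m1) szm1 => [|e [|]] // _; exists e.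
  have def_e : rcons [:: c] e = rcons m2 d by rewrite -def2 def1 def_m1.
  have [def_m2 def_d] := rcons_inj def_e; rewrite wcoefE /left_normed /= !wcoef_gen def_m1 -def_m2 -def_d.
  rewrite def_m1 in psign1 def1; rewrite -def_m2 -def_d in psign2.
  have -> : sphere w (fun s => psign s (prefixes [:: a; b])) = 1.
    by rewrite def1 /sphere /= big_nat1 !cone1 // mul1r.
  rewrite mul1r mulr1; move: pw bv; rewrite def1 inE => pw ne_ba.
  have : c \in [:: a; b] by rewrite -(perm_mem pw) mem_head.
  rewrite !inE => /orP[] /eqP def_c; rewrite def_c in psign1 psign2 def1 pw *.
    have /perm_mem/(_ e) : perm_eq [:: e] [:: b] by rewrite -(perm_cons a).
    rewrite !inE eqxx => /esym/eqP def_e'; rewrite -def1 psign2 // def_e' eqxx.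
    by rewrite psign_refl // eqxx [a == b]eq_sym (negPf ne_ba) mul0r subr0 mulr1.
  have /perm_mem/(_ e) : perm_eq [:: e] [:: a].
    by rewrite -(perm_cons b) (perm_trans pw) // (perm_catC [:: a] [:: b]).
  rewrite !inE eqxx => /esym/eqP def_e'; rewrite -def1 psign1 // def_e' eqxx.
  by rewrite psign_refl // eqxx [a == b]eq_sym (negPf ne_ba) mul0r sub0r expr1 !mulr1.
rewrite prefixes_rcons /=; last by lia.
have setE m x : perm_eq w (x :: m) -> ([set y in m] == [set y in a :: v]) = (x == b).
  move=> pm; have mem_m y : (y == x) || (y \in m) = (y == b) || (y \in a :: v).
    by have := perm_mem pw y; rewrite (perm_mem pm) mem_rcons !inE.
  have Um : x \notin m by move: Uw; rewrite (perm_uniq pm) => /andP[].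
  apply/eqP/eqP => [/setP eq_m|xb]; last first.
    apply/setP => y; rewrite !inE; have := mem_m y; rewrite xb inE.
    case: eqP => [->|_] //= _; move: bv Um; rewrite xb inE => /negPf-> /negPf->; done.
  apply/eqP; have := mem_m x; rewrite eqxx /= => /esym/orP[//|xv].
  by have := eq_m x; rewrite !inE in xv *; rewrite xv (negPf Um).
have cardU : #|[set y in a :: v]| = (size v).+1 by rewrite cardsE (card_uniqP Uv).
rewrite (@sphere_psign a w c d m1 m2) //; first last.
- move=> C; rewrite in_cons => /predU1P[->|/prefixes_head //]; by rewrite inE mem_head.
- by rewrite cardU szw.
- by rewrite szw; lia.
rewrite (setE m1 c) ?def1 // -def1 (setE m2 d) ?def2 ?perm_rcons // -def2 cardU wcoefE size_rcons.
rewrite mulrBr mulrDr addrC; congr (_ + _).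
  case: eqP => [cb|_]; last by rewrite !mul0r !mulr0 oppr0.
  rewrite !mul1r psign1 // -mulrA -IHv ?pm1 // binS bin1 exprD exprS; ring.
case: eqP => [db|_]; last by rewrite !mul0r !mulr0.
rewrite !mul1r psign2 // mulrCA -IHv ?pm2 // binS bin1 exprD; ring.
Qed.

End Combs.

(** * Dual cochains *)

Lemma fct_mulrz (T : Type) (f : T -> int) (k : int) x : (f *~ k) x = k * f x.
Proof.
have mulrn m : (f *+ m) x = f x *+ m by elim: m => [|m IHm] //; rewrite !mulrS -IHm.
case: k => m; first by rewrite -pmulrn mulrn -mulr_natl natz.
by rewrite NegzE mulrNz -pmulrn -[LHS]/(- ((f *+ m.+1) x)) mulrn -mulr_natl natz mulNr.
Qed.

Lemma fct_sum (T I : Type) (r : seq I) (P : pred I) (F : I -> T -> int) x :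
  (\sum_(i <- r | P i) F i) x = \sum_(i <- r | P i) F i x.
Proof.
elim: r => [|i r IH]; first by rewrite !big_nil.
by rewrite !big_cons; case: (P i); rewrite -IH.
Qed.

Section Elementary.
Variables (gT : finGroupType) (K : gcomplex gT).
Local Notation V := (vertex K).
Implicit Types (s t : seq V) (phi psi : seq V -> int) (d : int).

(** For an ordered simplex [t], the cochain with value 1 on [t] that vanishes on all
    sequences but the orderings of [t]. *)
Definition dual t : seq V -> int := fun s => psign s t.

Lemma ordered_simplex_perm s t : perm_eq s t -> ordered_simplex t -> ordered_simplex s.
Proof.
move=> st [Ut t_simp]; split; first by rewrite (perm_uniq st).
case: t_simp => [t0|]; first by left; apply: perm_nilP; rewrite -t0.
right; rewrite (_ : [fset x in s]%fset = [fset x in t]%fset) //.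
by apply/fsetP => x; rewrite !inE (perm_mem st).
Qed.

Lemma ordered_simplex_tail x s : ordered_simplex (x :: s) -> ordered_simplex s.
Proof.
case=> /andP[_ Us] [//|xs]; split=> //; case: s xs Us => [|y s] xs Us; [by left | right].
apply: simplex_sub xs _ _; first by apply/fsubsetP => z; rewrite !inE => ->; rewrite orbT.
by apply/fset0Pn; exists y; rewrite !inE eqxx.
Qed.

Lemma dual_cochain t d : ordered_simplex t -> (size t)%:Z = d + 1 -> cochain d (dual t).
Proof.
move=> t_simp szt; split=> [s /psign_perm_eq st|m r p]; last exact: psign_tuple.
by split; [exact: ordered_simplex_perm st t_simp | rewrite (perm_size st)].
Qed.

Lemma cochain_perm d phi s t : cochain d phi -> perm_eq s t -> uniq t ->
  phi s = psign s t * phi t.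
Proof.
case=> _ phiP st Ut.
have /tuple_permP[p def_s] : perm_eq s (in_tuple t) by [].
by rewrite def_s phiP psign_tuple psign_refl ?mulr1.
Qed.

Lemma dual_perm s t : perm_eq s t -> uniq t -> dual s = dual t *~ psign s t.
Proof.
move=> st Ut; apply/funext => r; rewrite fct_mulrz /dual psign_sym mulrC.
have [rt|n_rt] := boolP (perm_eq r t).
  by rewrite [psign s t]psign_sym psign_mul // psign_sym.
have -> : psign r t = 0 by apply: contraNeq n_rt => /psign_perm_eq.
rewrite mul0r; apply: contraNeq n_rt => /psign_perm_eq sr.
by rewrite perm_sym in sr; exact: perm_trans sr st.
Qed.

(** If deleting an entry of [s] leaves an ordering of [t], then that entry is the only
    vertex [x] for which [s] is an ordering of [x :: t], and the signs agree by
    Laplace expansion. *)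
Lemma delta_dual (vs : seq V) t : uniq vs ->
  (forall s, ordered_simplex s -> {subset s <= vs}) ->
  delta (dual t) = \sum_(x <- vs | asbool (ordered_simplex (x :: t))) dual (x :: t).
Proof.
move=> Uvs vsP; apply/funext => s; rewrite fct_sum /delta.
case: asboolP => [s_simp|s_not]; last first.
  rewrite big1 // => x /asboolP xt; apply/eqP/negPn/negP => /psign_perm_eq sx.
  exact: s_not (ordered_simplex_perm sx xt).
rewrite (eq_bigr _ (fun x _ => psign_consr x s t)) exchange_big /=; apply: eq_bigr => i _.
rewrite -mulr_suml -mulr_sumr /dual; have [->|nz] := eqVneq (psign (take i s ++ drop i.+1 s) t) 0.
  by rewrite !mulr0.
have /hasP[x0 _ _] : has predT s.
  by rewrite has_predT (leq_ltn_trans _ (ltn_ord i)).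
set x := nth x0 s i.
have nthE y : nth y s i = x by apply: set_nth_default.
have xs : x \in s by rewrite mem_nth.
have xt_perm : perm_eq (x :: t) s.
  rewrite perm_sym -{1}(cat_take_drop i s) (drop_nth x0) // perm_catC /= perm_cons perm_catC.
  exact: psign_perm_eq.
have xt := ordered_simplex_perm xt_perm s_simp.
rewrite (big_rem x) ?(vsP s) //=; have -> : `[< ordered_simplex (x :: t) >] by apply/asboolP.
rewrite nthE eqxx big1_seq ?addr0 ?mulr1 // => y /andP[_].
by rewrite mem_rem_uniq // !inE nthE => /andP[/negPf + _]; rewrite eq_sym => ->.
Qed.

End Elementary.

(** * Top cochains modulo coboundaries *)

Section Top.
Variables (gT : finGroupType) (A : finType) (to : lact gT A) (a0 : A).
Hypothesis A1 : (1 < #|A|)%N.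
Local Notation K := (tree_complex to).
Local Notation V := (vertex K).
Local Notation tails := (tails a0).
Local Notation d := (#|A|%:Z - 3).
Implicit Types (C D : {set A}) (t s : seq {set A}) (v w u : seq A) (phi psi : seq V -> int).

(** [tau] with the vertex type of the complex, which depends on the action. *)
Definition vtau C : V := tau a0 C.

Definition taus t : seq V := map vtau t.

Lemma taus_inj t : {in t, forall C, cluster C} ->
  {in t &, injective vtau}.
Proof. by move=> tcl C D /tcl C1 /tcl D1; apply: tau_inj; exact: cluster_neq0. Qed.

Lemma mem_taus t C : {in t, forall C, cluster C} -> cluster C ->
  (vtau C \in taus t) = (C \in t).
Proof.
move=> tcl C1; apply/mapP/idP => [[D Dt]|Ct]; last by exists C.
by move=> /(tau_inj (cluster_neq0 C1) (cluster_neq0 (tcl D Dt)))->.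
Qed.

Lemma laminar_simplex t : {in t, forall C, cluster C} -> uniq t -> laminar t ->
  ordered_simplex (taus t).
Proof. by move=> tcl Ut tL; apply/ordered_simplex_tau. Qed.

(** The cochain dual to the comb with leaves [a0 :: v]. *)
Definition comb v : seq V -> int := dual (taus (prefixes (a0 :: v))).

Definition comb_or_coboundary phi : Prop :=
  (exists2 v, v \in tails & phi = comb v) \/
  (exists2 psi, cochain (d - 1) psi & phi = delta psi).

Local Notation spanned := (@Defs.span (seq V -> int : zmodType) comb_or_coboundary).

Lemma dual_taus_perm s t : perm_eq s t -> {in t, forall C, cluster C} -> uniq t ->
  dual (taus s) = dual (taus t) *~ psign s t.
Proof.
move=> st tcl Ut; have scl : {in s, forall C, cluster C} by move=> C; rewrite (perm_mem st); exact: tcl.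
rewrite (@dual_perm _ K _ (taus t)) ?perm_map //.
  by rewrite psign_map // => C D Cs Dt; apply: (taus_inj tcl); rewrite // -(perm_mem st).
by rewrite map_inj_in_uniq //; exact: taus_inj.
Qed.

(** The clusters of the simplex all contain [a0], so that they form a chain; its
    length is maximal, whence it consists of the initial segments of a word. *)
Lemma dual_chain_spanned t : {in t, forall C, cluster C} -> uniq t -> laminar t ->
  size t = (#|A| - 2)%N -> {in t, forall C, a0 \in C} -> dual (taus t) \in spanned.
Proof.
move=> tcl Ut tL szt ta0.
have [v [Uv Cv pv]] : exists v,
    [/\ uniq (a0 :: v), [set x in a0 :: v] = setT & perm_eq t (prefixes (a0 :: v))].
  apply: chain_word; rewrite ?cardsT ?szt // => C Ct.
  by have /andP[C1 CA] := tcl C Ct; split=> //; [rewrite properEcard subsetT cardsT|exact: ta0].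
have prcl : {in prefixes (a0 :: v), forall C, cluster C} by move=> C; rewrite -(perm_mem pv); exact: tcl.
rewrite (dual_taus_perm pv) ?prefixes_uniq //; apply: rpredMz; apply/asboolP/span_gen.
left; exists v => //; rewrite mem_tails; apply: uniq_perm; rewrite ?enum_uniq // => x.
by rewrite mem_enum; have /setP/(_ x) := Cv; rewrite !inE.
Qed.

(** A cluster that can replace [C] is not compatible with [C], by maximality of the
    simplex. If it misses [a0] too, then so does its union with [C], which is
    compatible with the whole simplex: this contradicts the choice of [C]. *)
Lemma replacement_contains (C D : {set A}) t : {in D :: C :: t, forall E, cluster E} ->
  uniq (C :: t) -> laminar (C :: t) -> size (C :: t) = (#|A| - 2)%N ->
  a0 \notin C -> {in t, forall E : {set A}, a0 \notin E -> (#|E| <= #|C|)%N} ->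
  uniq (D :: t) -> laminar (D :: t) -> D != C -> a0 \in D.
Proof.
move=> cl Ut tL szt aC Cmax Ud dL ne_DC; apply/negPn/negP => aD.
have Dt : D \notin t by move: Ud => /andP[].
have too_big E : cluster E -> E \notin C :: t -> {in C :: t, forall F, compat E F} -> False.
  move=> E1 nE cE; have := @laminar_size _ a0 A1 (E :: C :: t); rewrite [size _]/= -/(size (C :: t)) szt.
  have -> : uniq (E :: C :: t) by rewrite cons_uniq nE.
  move=> lam; have : ((#|A| - 2).+1 <= #|A| - 2)%N; last by rewrite ltnn.
  apply: lam => //.
    by move=> F; rewrite in_cons => /predU1P[->//|Ft]; apply: cl; rewrite inE Ft orbT.
  move=> F G; rewrite !(in_cons E) => /predU1P[->|Fs] /predU1P[->|Gs].
  - by rewrite /compat subxx.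
  - exact: cE.
  - by rewrite compatC; exact: cE.
  - exact: tL.
have CDcompat : ~~ compat D C.
  apply/negP => DC; apply: (too_big D); first by apply: cl; exact: mem_head.
    by rewrite inE negb_or ne_DC.
  by move=> F; rewrite inE => /predU1P[->//|Ft]; apply: dL; rewrite ?mem_head // inE Ft orbT.
move: CDcompat; rewrite /compat !negb_or => /and3P[nDC nCD /pred0Pn[b /andP[/= bD bC]]].
pose U := C :|: D.
have aU : a0 \notin U by rewrite inE negb_or aC.
have U1 : cluster U.
  have /andP[C1 _] : cluster C by apply: cl; rewrite !inE eqxx orbT.
  rewrite /cluster (leq_trans C1) ?subset_leq_card ?subsetUl //= -cardsT; apply: proper_card.
  by apply/properP; split; [exact: subsetT | exists a0; rewrite ?inE // in aU *].
have ltCU : (#|C| < #|U|)%N.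
  apply: proper_card; rewrite properE subsetUl; apply/negP => UC; case/negP: nDC.
  exact: subset_trans (subsetUr _ _) UC.
apply: (too_big U) => //.
  rewrite inE negb_or; apply/andP; split; first by apply: contraTneq ltCU => ->; rewrite ltnn.
  by apply/negP => Ut'; have := Cmax U Ut' aU; rewrite leqNgt ltCU.
move=> F; rewrite inE => /predU1P[->|Ft]; first by rewrite /compat subsetUl orbT.
have cFC : compat F C by apply: tL; rewrite ?mem_head // inE Ft orbT.
have cFD : compat F D by apply: dL; rewrite ?mem_head // inE Ft orbT.
rewrite compatC; case/or3P: cFC => [FC|CF|dFC].
- by rewrite /compat (subset_trans FC) ?subsetUl.
- case/or3P: cFD => [FD|DF|/pred0P/(_ b)].
  + by case/negP: nCD; exact: subset_trans CF FD.
  + by rewrite /compat [U \subset F]subUset CF DF orbT.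
  + by rewrite /= bD (subsetP CF).
case/or3P: cFD => [FD|DF|dFD].
- by rewrite /compat (subset_trans FD) ?subsetUr.
- by move/pred0P/(_ b): dFC; rewrite /= bC (subsetP DF).
- by rewrite /compat -[[disjoint F & U]]setI_eq0 setIUr setU_eq0 !setI_eq0 dFC dFD !orbT.
Qed.

(** Induction on the number of clusters that miss [a0]. Remove from [t] a maximal one:
    the coboundary of what remains is the sum of the duals of all its replacements,
    and all but [t] itself have fewer clusters missing [a0]. *)
Lemma dual_spanned t : {in t, forall C, cluster C} -> uniq t -> laminar t ->
  size t = (#|A| - 2)%N -> dual (taus t) \in spanned.
Proof.
have [k] := ubnP (count (fun C : {set A} => a0 \notin C) t).
elim: k t => // k IH t lt_k tcl Ut tL szt.
have [/hasP[C0 C0t aC0]|/hasPn no_a] := boolP (has (fun C : {set A} => a0 \notin C) t); last first.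
  by apply: dual_chain_spanned => // C Ct; apply/negPn; exact: no_a.
have [C [Ct aC Cmax]] : exists C, [/\ C \in t, a0 \notin C &
    forall D, D \in t -> a0 \notin D -> (#|D| <= #|C|)%N].
  have PC0 : (C0 \in t) && (a0 \notin C0) by rewrite C0t.
  case: (@arg_maxnP _ C0 (fun C => (C \in t) && (a0 \notin C)) (fun C => #|C|) PC0) => C /andP[Ct aC] Cmax.
  by exists C; split=> // D Dt aD; apply: Cmax; rewrite Dt.
pose t' := rem C t; have pt : perm_eq t (C :: t') := perm_to_rem Ct.
have mem_t D : (D \in t) = (D \in C :: t') := perm_mem pt D.
have Ut' : uniq (C :: t') by rewrite -(perm_uniq pt).
have tcl' : {in C :: t', forall C, cluster C} by move=> D; rewrite -mem_t; exact: tcl.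
have tL' : laminar (C :: t') by move=> D E; rewrite -!mem_t; exact: tL.
have szt' : size (C :: t') = (#|A| - 2)%N by rewrite -(perm_size pt).
rewrite (dual_taus_perm pt) //; apply: rpredMz.
have simp_t' : ordered_simplex (taus t').
  by apply: (@ordered_simplex_tail _ K (vtau C)); exact: (laminar_simplex tcl').
pose clus := enum [pred C : {set A} | cluster C].
have clusP D : (D \in clus) = cluster D by rewrite mem_enum.
have Uvs : uniq (taus clus).
  rewrite map_inj_in_uniq ?enum_uniq //; apply: taus_inj => D; by rewrite clusP.
have vsP (r : seq V) : ordered_simplex r -> {subset r <= taus clus}.
  move=> /(ordered_simplexP a0)[q qcl ->] x /mapP[D Dq ->]; apply: map_f.
  by rewrite clusP; exact: qcl.
have := @delta_dual _ K (taus clus) (taus t') Uvs vsP.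
rewrite big_map (big_rem C) ?clusP ?tcl //=.
have -> : `[< ordered_simplex (vtau C :: taus t') >] by apply/asboolP/(laminar_simplex tcl').
rewrite -[vtau C :: taus t']/(taus (C :: t')) => /(canLR (addrK _)) <-.
rewrite rpredB //.
  apply/asboolP/span_gen; right; exists (dual (taus t')) => //; apply: dual_cochain => //.
  by rewrite size_map; move: szt' => /=; lia.
rewrite big_seq_cond; apply: rpred_sum => D /andP[].
rewrite mem_rem_uniq ?enum_uniq // inE /= clusP => /andP[ne_DC D1] /asboolP D_simp.
have dcl : {in D :: t', forall E, cluster E}.
  by move=> E; rewrite inE => /predU1P[->|Et] //; apply: tcl'; rewrite inE Et orbT.
have /(ordered_simplex_tau to a0 A1 dcl)[Ud dL] : ordered_simplex (taus (D :: t')) := D_simp.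
have aD : a0 \in D.
  apply: (@replacement_contains C D t') => //.
  - by move=> E; rewrite inE => /predU1P[->|/tcl'].
  - by move=> E Et; apply: Cmax; rewrite mem_t inE Et orbT.
apply: (IH (D :: t')) => //.
by move: lt_k; rewrite (seq.permP pt) /= aC aD.
Qed.

(** A cochain is the sum of its values on unordered simplices times the dual
    cochains; the simplices are indexed by sets of clusters. *)
Lemma cochain_spanned phi : cochain d phi -> phi \in spanned.
Proof.
move=> cphi.
have -> : phi = \sum_(B : {set {set A}} | [forall C in B, cluster C])
    dual (taus (enum B)) *~ phi (taus (enum B)).
  apply/funext => s; rewrite fct_sum; under eq_bigr => B _ do rewrite fct_mulrz.
  have enumcl (B : {set {set A}}) : [forall C in B, cluster C] -> {in enum B, forall C, cluster C}.
    by move=> /forall_inP Bcl C; rewrite mem_enum; exact: Bcl.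
  have enumU (B : {set {set A}}) : [forall C in B, cluster C] -> uniq (taus (enum B)).
    by move=> Bcl; rewrite map_inj_in_uniq ?enum_uniq //; apply/taus_inj/enumcl.
  have termE (B : {set {set A}}) : [forall C in B, cluster C] ->
      phi (taus (enum B)) * dual (taus (enum B)) s =
      if perm_eq s (taus (enum B)) then phi s else 0.
    move=> Bcl; case: ifP => [sB|/negbT n_sB].
      by rewrite (cochain_perm cphi sB (enumU B Bcl)) mulrC.
    by have -> : dual (taus (enum B)) s = 0; rewrite ?mulr0 //; apply: contraNeq n_sB => /psign_perm_eq.
  rewrite (eq_bigr _ termE); have [phis0|nz] := eqVneq (phi s) 0.
    by rewrite big1 // => B _; rewrite phis0 if_same.
  have [s_simp _] := cphi.1 s nz; have [t tcl def_s] := ordered_simplexP a0 s_simp.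
  have [Ut _] : uniq t /\ laminar t.
    by apply/(ordered_simplex_tau to a0 A1 tcl); rewrite def_s in s_simp.
  have B0cl : [forall C in [set C in t], cluster C].
    by apply/forall_inP => C; rewrite inE; exact: tcl.
  have pt : perm_eq t (enum [set C in t]).
    by apply: uniq_perm; rewrite ?enum_uniq // => C; rewrite mem_enum inE.
  rewrite (bigD1 [set C in t]) //= [X in perm_eq X _]def_s (perm_map _ pt) big1 ?addr0 // => B /andP[Bcl ne_B].
  case: ifP => // sB; case/eqP: ne_B; apply/setP => C; rewrite inE.
  have := perm_mem sB (vtau C); rewrite def_s; have [C1|nC] := boolP (cluster C).
    by rewrite !mem_taus ?mem_enum //; exact: enumcl.
  move=> _; have -> : C \in t = false by apply: contraNF nC; exact: tcl.
  by apply: contraNF nC; move/forall_inP: Bcl; apply.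
apply: rpred_sum => B Bcl; have [->|nz] := eqVneq (phi (taus (enum B))) 0; first by rewrite mulr0z rpred0.
have tcl : {in enum B, forall C, cluster C}.
  by move=> C; rewrite mem_enum; move/forall_inP: Bcl; apply.
have [B_simp szB] := cphi.1 _ nz; have /(ordered_simplex_tau to a0 A1 tcl)[UB BL] := B_simp.
apply: rpredMz; apply: dual_spanned => //.
by move: szB; rewrite size_map; move: A1; lia.
Qed.

End Top.

(** * The pairing of cochains with words *)

Section Pairing.
Variables (gT : finGroupType) (A : finType) (to : lact gT A) (a0 : A).
Hypothesis A1 : (1 < #|A|)%N.
Local Notation K := (tree_complex to).
Local Notation V := (vertex K).
Local Notation tails := (tails a0).
Local Notation d := (#|A|%:Z - 3).
Local Notation gen a := (\pi_(free_lie A) (Lgen a)).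
Local Notation taus := (taus to a0).
Local Notation comb := (@comb gT A to a0).
Implicit Types (C D : {set A}) (t s : seq {set A}) (v w u : seq A) (phi psi : seq V -> int).

(** The value of a cochain on the fundamental cycle of the planar trees with leaves
    [w], with the sign of [w] relative to the enumeration of [A]. The constant sign
    is the one that comes from [wcoef_comb]. *)
Definition pairing phi w : int :=
  (-1) ^+ 'C(#|A|.-1, 2) * (psign w (enum A) * sphere w (fun s => phi (taus s))).

Lemma pairingB phi psi w : pairing (phi - psi) w = pairing phi w - pairing psi w.
Proof.
rewrite /pairing (_ : (fun s => (phi - psi) (taus s)) = fun s => phi (taus s) - psi (taus s)) //.
by rewrite sphereB; ring.
Qed.

Lemma pairing0 w : pairing 0 w = 0.
Proof. by rewrite -(subrr 0) pairingB subrr. Qed.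

Lemma size_word w : perm_eq w (enum A) -> size w = #|A|.
Proof. by move=> pw; rewrite (perm_size pw) -cardE. Qed.

Lemma uniq_word w : perm_eq w (enum A) -> uniq w.
Proof. by move=> pw; rewrite (perm_uniq pw) enum_uniq. Qed.

Lemma set_word w : perm_eq w (enum A) -> [set x in w] = setT.
Proof. by move=> pw; apply/setP => x; rewrite !inE (perm_mem pw) mem_enum. Qed.

Lemma eq_sphere_word w f g : perm_eq w (enum A) ->
  (forall s, [/\ size s = (#|A| - 2)%N, uniq s, {in s, forall C, cluster C} & laminar s] -> f s = g s) ->
  sphere w f = sphere w g.
Proof.
move=> pw fg; apply: eq_sphere; rewrite ?uniq_word ?size_word //.
rewrite set_word // => s [szs Us sP sL]; apply: fg; split=> //; first by rewrite szs; lia.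
by move=> C /sP[/proper_card]; rewrite cardsT /cluster => -> ->.
Qed.

(** The pairing is with a cycle. *)
Lemma pairing_delta psi w : perm_eq w (enum A) -> pairing (delta psi) w = 0.
Proof.
move=> pw; rewrite /pairing.
rewrite (eq_sphere_word (g := bd (fun s => psi (taus s))) pw) ?sphere_bd ?uniq_word ?mulr0 //.
move=> s [szs Us scl sL]; rewrite /delta; case: asboolP => [_|[]]; last exact: laminar_simplex.
by rewrite size_map; apply: eq_bigr => i _; rewrite /taus -map_take -map_drop -map_cat.
Qed.

Lemma prefixes_cluster v : perm_eq (a0 :: v) (enum A) -> {in prefixes (a0 :: v), forall C, cluster C}.
Proof.
move=> pv C /(prefixesP (uniq_word pv))[]; rewrite set_word // => /proper_card.
by rewrite cardsT /cluster => -> ->.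
Qed.

Lemma pairing_comb v w : v \in tails -> perm_eq w (enum A) ->
  pairing (comb v) w = psign (a0 :: v) (enum A) * wcoef (left_normed (gen a0) v) w.
Proof.
rewrite mem_tails => pv pw; rewrite /pairing.
have pwv : perm_eq w (a0 :: v) by rewrite (perm_trans pw) // perm_sym.
rewrite (eq_sphere_word (g := fun s => psign s (prefixes (a0 :: v))) pw); last first.
  move=> s [_ _ scl _]; apply: psign_map => C D Cs Dv.
  by apply: tau_inj; [exact: cluster_neq0 (scl C Cs) | exact: cluster_neq0 (prefixes_cluster pv Dv)].
have szv : size v = #|A|.-1 by rewrite -(size_word pv).
rewrite -(@psign_mul _ (a0 :: v) w) ?uniq_word // mulrAC -wcoef_comb ?uniq_word //; last by lia.
rewrite szv !mulrA -exprD addnn -mul2n exprM sqrrN !expr1n mul1r; exact: mulrC.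
Qed.

Lemma psign_sq w : perm_eq w (enum A) -> psign w (enum A) * psign w (enum A) = 1.
Proof.
move=> pw; rewrite [X in _ * X]psign_sym psign_mul ?enum_uniq // psign_refl //; exact: uniq_word.
Qed.

(** The matrix of [g] is the incidence matrix of the enumeration of [A] with its image. *)
Lemma psign_act g w : perm_eq w (enum A) ->
  psign (map (to g) w) (enum A) = \det (act_mx to g) * psign w (enum A).
Proof.
move=> pw; have g_inj : injective (to g) := can_inj (lopK to g).
have x0 : A by case: (pickP (@predT A)) A1 => [x //|no]; rewrite eq_card0.
have valE (i : 'I_#|A|) : enum_val i = nth x0 (enum A) i by exact: enum_val_nth.
have Ue := enum_uniq A; have szA : size (enum A) = #|A| by rewrite -cardE.
move: (enum A) pw valE Ue szA => e pw valE Ue szA.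
rewrite -(@psign_mul _ (map (to g) e)) ?perm_map ?map_inj_uniq //.
rewrite psign_map => [|x y _ _]; last exact: g_inj.
rewrite mulrC; congr (_ * _).
have szgA : size (map (to g) e) = #|A| by rewrite size_map.
rewrite psign_sym (psignE x0 szA szgA); congr (\det _); apply/matrixP => i j; rewrite !mxE.
by rewrite (nth_map x0) ?szA // !valE.
Qed.

Lemma pairing_act g phi w : perm_eq w (enum A) ->
  pairing (cf_op g phi) w = \det (act_mx to g) * pairing phi (map (to g^-1%g) w).
Proof.
move=> pw; have pgw : perm_eq (map (to g^-1%g) w) (enum A).
  apply: uniq_perm; rewrite ?enum_uniq // ?map_inj_uniq ?uniq_word //.
    exact: can_inj (lopK to _).
  by move=> x; rewrite mem_enum -[x](lopK to g) map_f // (perm_mem pw) mem_enum.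
have {1}-> : pairing (cf_op g phi) w = (-1) ^+ 'C(#|A|.-1, 2) *
    (psign w (enum A) * sphere (map (to g^-1%g) w) (fun s => phi (taus s))).
  rewrite /pairing sphere_map; congr (_ * (_ * _)); apply: eq_sphere_word => // s [_ _ scl _].
  rewrite /cf_op /taus -!map_comp; congr phi; apply/eq_in_map => C Cs.
  by rewrite -[LHS]/(vact K _ (tau a0 C)) (tau_act to) //; exact: cluster_neq0 (scl C Cs).
have {1}-> : w = map (to g) (map (to g^-1%g) w).
  by rewrite -map_comp map_id_in // => x _; exact: lopVK.
by rewrite psign_act // /pairing; ring.
Qed.

(** The element of the free Lie algebra in which the words that start with [a0] have
    the pairings with [phi] as coefficients, by [wcoef_left_normed]. *)
Definition to_lie phi : free_lie A :=
  \sum_(v <- tails) left_normed (gen a0) v *~ pairing phi (a0 :: v).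

Lemma to_lieB phi psi : to_lie (phi - psi) = to_lie phi - to_lie psi.
Proof. by rewrite -sumrB; apply: eq_bigr => v _; rewrite pairingB mulrzBr. Qed.

Lemma tail_word v : v \in tails -> perm_eq (a0 :: v) (enum A).
Proof. by rewrite mem_tails. Qed.

Lemma pairing_comb_tail u v : u \in tails -> v \in tails ->
  pairing (comb u) (a0 :: v) = psign (a0 :: u) (enum A) * (v == u)%:R.
Proof.
move=> uT vT; rewrite pairing_comb ?tail_word // wcoef_left_normed //; exact: uniq_word (tail_word uT).
Qed.

Lemma sum_tails (M : zmodType) (F : seq A -> M) u (k : int) : u \in tails ->
  \sum_(v <- tails) F v *~ (k * (v == u)%:R) = F u *~ k.
Proof.
move=> uT; rewrite (bigD1_seq u) ?permutations_uniq //= eqxx mulr1 big1 ?addr0 // => v /negPf->.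
by rewrite mulr0 mulr0z.
Qed.

Lemma to_lie_comb u : u \in tails -> to_lie (comb u) = left_normed (gen a0) u *~ psign (a0 :: u) (enum A).
Proof.
move=> uT; rewrite -(sum_tails (left_normed (gen a0)) _ uT) /to_lie big_seq [RHS]big_seq.
by apply: eq_bigr => v vT; rewrite pairing_comb_tail.
Qed.

Lemma to_lie_delta psi : to_lie (delta psi) = 0.
Proof.
by rewrite /to_lie big_seq big1 // => v vT; rewrite pairing_delta ?mulr0z ?tail_word.
Qed.

(** By definition this holds for words that start with [a0]. For all other words it
    follows from the case of combs, and this makes the isomorphism equivariant,
    although [a0] is not fixed by the group. *)
Lemma pairing_wcoef phi w : cochain d phi -> perm_eq w (enum A) -> pairing phi w = wcoef (to_lie phi) w.
Proof.
move=> /(cochain_spanned a0 A1)/asboolP sp pw.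
elim: sp => [|x [[v vT ->]|[psi _ ->]]|x y _ IHx _ IHy].
- by rewrite pairing0 -(delta0 K) to_lie_delta wcoef0.
- by rewrite pairing_comb // to_lie_comb // wcoefMz.
- by rewrite pairing_delta // to_lie_delta wcoef0.
- by rewrite pairingB to_lieB wcoefB IHx IHy.
Qed.

(** Modulo coboundaries, a cochain is the combination of combs that has the same
    pairings with the words that start with [a0]. *)
Lemma pairing_eq0 phi : cochain d phi -> (forall v, v \in tails -> pairing phi (a0 :: v) = 0) ->
  exists2 psi, cochain (d - 1) psi & phi = delta psi.
Proof.
move=> /(cochain_spanned a0 A1)/asboolP sp phi0.
have [psi cpsi def_phi] : exists2 psi, cochain (d - 1) psi &
    phi - \sum_(v <- tails) comb v *~ (psign (a0 :: v) (enum A) * pairing phi (a0 :: v)) = delta psi.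
  elim: {phi0} sp => [|x [[u uT ->]|[psi cpsi ->]]|x y _ [p cp dp] _ [q cq dq]].
  - exists 0; first exact: cochain0.
    rewrite delta0 big_seq big1 ?subr0 // => v vT.
    by rewrite pairing0 mulr0 mulr0z.
  - exists 0; first exact: cochain0.
    rewrite delta0 big_seq (eq_bigr (fun v => comb v *~ (1 * (v == u)%:R))); last first.
      move=> v vT; rewrite pairing_comb_tail //; have [->|] := eqVneq v u; last by rewrite !mulr0.
      by rewrite mulrA psign_sq // tail_word.
    by rewrite -big_seq (sum_tails comb 1 uT) mulr1z subrr.
  - exists psi => //; rewrite big_seq big1 ?subr0 // => v vT.
    by rewrite pairing_delta ?mulr0 ?mulr0z ?tail_word.
  - exists (p - q); first exact: cochainB.
    rewrite deltaB -dp -dq [in RHS]opprD addrACA; congr (_ + _).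
    rewrite opprK addrC -sumrB -sumrN; apply: eq_bigr => v _.
    by rewrite pairingB mulrBr mulrzBr opprB.
exists psi => //; rewrite -def_phi big_seq big1 ?subr0 // => v vT.
by rewrite phi0 // mulr0 mulr0z.
Qed.

(** There are no simplices of larger dimension. *)
Lemma cochain_cocycle phi : cochain d phi -> phi \in cocycle d.
Proof.
move=> cphi; apply/asboolP; split=> //; apply/funext => s; rewrite /delta.
case: asboolP => // s_simp; rewrite big1 // => i _.
have [->|/cphi.1[_]] := eqVneq (phi (take i s ++ drop i.+1 s)) 0; first by rewrite mulr0.
have [t tcl def_s] := ordered_simplexP a0 s_simp; rewrite def_s in s_simp.
have /(ordered_simplex_tau to a0 A1 tcl)[Ut tL] := s_simp.
have := laminar_size a0 A1 tcl Ut tL; have szs : size s = size t by rewrite def_s size_map.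
have lti : (i < size s)%N := ltn_ord i.
have t_gt0 : (0 < size t)%N by rewrite -szs (leq_ltn_trans _ lti).
have absurd n m : (1 < n)%N -> (0 < m)%N -> (m <= n - 2)%N -> m.-1%:Z = n%:Z - 3 + 1 -> False by lia.
by rewrite size_del // => le_t szd; rewrite szs in szd; case: (absurd _ _ A1 t_gt0 le_t szd).
Qed.

Lemma comb_cochain v : v \in tails -> cochain d (comb v).
Proof.
rewrite mem_tails => pv; apply: dual_cochain.
  apply: laminar_simplex => //; [exact: prefixes_cluster | | exact: prefixes_laminar].
  exact/prefixes_uniq/uniq_word.
by rewrite size_map size_prefixes (size_word pv); lia.
Qed.

End Pairing.

(** * Twisted modules and the isomorphism *)

Lemma inj_surj_bij (X Y : Type) (f : X -> Y) :
  injective f -> (forall y, exists x, f x = y) -> bijective f.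
Proof.
move=> f_inj /choice[g gK]; exists g => // x.
by apply: f_inj; rewrite gK.
Qed.

Section Morphisms.
Variables (M N : zmodType) (f : M -> N).
Hypothesis fB : zmod_morphism f.

Lemma morph0 : f 0 = 0.
Proof. by rewrite -(subrr 0) fB subrr. Qed.

Lemma morphN x : f (- x) = - f x.
Proof. by rewrite -sub0r fB morph0 sub0r. Qed.

Lemma morphD x y : f (x + y) = f x + f y.
Proof. by rewrite -{1}[y]opprK fB morphN opprK. Qed.

Lemma morphMz x (k : int) : f (x *~ k) = f x *~ k.
Proof.
have fMn n : f (x *+ n) = f x *+ n.
  by elim: n => [|n IHn]; rewrite ?morph0 // !mulrS morphD IHn.
by case: k => n; rewrite ?NegzE ?mulrNz -!pmulrn ?morphN fMn.
Qed.

Lemma morph_sum (I : Type) (r : seq I) (P : pred I) (F : I -> M) :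
  f (\sum_(i <- r | P i) F i) = \sum_(i <- r | P i) f (F i).
Proof.
elim: r => [|i r IH]; first by rewrite !big_nil morph0.
by rewrite !big_cons; case: (P i); rewrite ?morphD IH.
Qed.

End Morphisms.

Section QuotientMap.
Variables (M : zmodType) (S : zmodClosed M).
Local Notation Q := (Quotient.quot S).

Lemma quot_eq (x y : M) : \pi_Q x = \pi_Q y <-> x - y \in S.
Proof.
by split=> [/eqP|xy]; [rewrite -Quotient.idealrBE | apply/eqP; rewrite -Quotient.idealrBE].
Qed.

Lemma piB : zmod_morphism (fun x : M => \pi_Q x : Q).
Proof. by move=> x y; rewrite !piE. Qed.

Lemma repr_pi (x : M) : repr (\pi_Q x) - x \in S.
Proof. by apply/quot_eq; rewrite reprK. Qed.

End QuotientMap.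

Section Twist.
Variables (gT : finGroupType) (A : finType) (to : lact gT A) (N : gmodule gT).
Local Notation E := (epsilon to).
Local Notation T := (tensor E N).
Local Notation F := {freeg (E * N)%type / int}.
Local Notation S := (@Defs_span__canonical__Algebra_ZmodClosed (free_pairs E N) (@bilin_rel gT E N)).

Local Notation Q := (Quotient.quot S).

Definition pure (x : N) : T := \pi_Q (<< (1 : E, x) >> : F).

Lemma pi_zmod : zmod_morphism (fun y : F => \pi_Q y : T).
Proof. exact: (@piB _ S). Qed.

Lemma pi_bilin (y z z' : F) : bilin_rel (y - z - z' : free_pairs E N) ->
  \pi_Q y = \pi_Q z + \pi_Q z' :> T.
Proof.
move=> yz; rewrite -(morphD pi_zmod); apply/(@quot_eq _ S).
by apply/asboolP/span_gen; rewrite opprD addrA.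
Qed.

Lemma pi_l x : zmod_morphism (fun k : E => \pi_Q (<< (k, x) >> : F) : T).
Proof.
move=> k l; have := pi_bilin (@bilin_l _ E N (k - l) l x); rewrite subrK => ->.
by rewrite addrK.
Qed.

Lemma pure_zmod : zmod_morphism pure.
Proof.
move=> x y; have := pi_bilin (@bilin_r _ E N 1 (x - y) y); rewrite subrK /pure => ->.
by rewrite addrK.
Qed.

Definition unpure_free : F -> N := @fglift int (zmodule N) (E * N)%type (fun kx => kx.2 *~ kx.1).

Lemma unpure_freeB : zmod_morphism unpure_free.
Proof. exact: (@lift_is_additive int (E * N)%type (zmodule N)). Qed.

Lemma unpure_freeU (c : int) (k : E) x : unpure_free << c *g (k, x) >> = x *~ k *~ c.
Proof. by rewrite /unpure_free liftU. Qed.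

Lemma unpure_free_rel y : y \in S -> unpure_free y = 0.
Proof.
move/asboolP; elim=> [|_ [k l x|k x y']|x y' _ IHx _ IHy].
- exact: morph0 unpure_freeB.
- by rewrite !unpure_freeB !unpure_freeU !mulr1z mulrzDr addrAC addrK subrr.
- by rewrite !unpure_freeB !unpure_freeU !mulr1z mulrzDl addrAC addrK subrr.
- by rewrite unpure_freeB IHx IHy subrr.
Qed.

Definition unpure (y : T) : N := unpure_free (repr y).

Lemma unpure_pi y : unpure (\pi_Q y) = unpure_free y.
Proof.
by apply/eqP; rewrite -subr_eq0 -unpure_freeB unpure_free_rel //; exact: (@repr_pi _ S).
Qed.

Lemma pureK : cancel pure unpure.
Proof. by move=> x; rewrite /pure unpure_pi unpure_freeU !mulr1z. Qed.

Lemma unpureK : cancel unpure pure.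
Proof.
elim/quotW=> y; rewrite unpure_pi -[y]freeg_sumE.
rewrite (morph_sum unpure_freeB) (morph_sum pure_zmod) (morph_sum pi_zmod).
apply: eq_bigr => -[k x] _; rewrite unpure_freeU !(morphMz pure_zmod).
have -> : << coeff (k, x) y *g (k, x) >> = << (k, x) >> *~ coeff (k, x) y :> F.
  by apply/eqP/freeg_eqP => z; rewrite raddfMz /= !coeffU mul1r mulrzz mulrC.
rewrite (morphMz pi_zmod); congr (_ *~ _).
rewrite -[k in RHS](intz k) /pure.
by rewrite -(morphMz (pi_l x)).
Qed.

Lemma pure_act g x : Defs.gact T g (pure x) = pure (Defs.gact N g x) *~ \det (act_mx to g).
Proof.
have act_pi : Defs.gact T g (pure x) = \pi_Q (<< (\det (act_mx to g), Defs.gact N g x) >> : F).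
  rewrite /pure; apply: etrans (quot_opE _ g _) _; first exact: span_stable (@bilin_rel_stable gT E N).
  by rewrite /= ten_opU /= /eps_op mulr1.
by rewrite act_pi /pure -(morphMz (pi_l (Defs.gact N g x))) intz.
Qed.

(** The tensor product with a module of rank one is the other factor with its action
    twisted by the determinant. *)
Lemma gmod_iso_tensor (H : gmodule gT) (f : H -> N) : zmod_morphism f -> bijective f ->
  (forall g x, f (Defs.gact H g x) = Defs.gact N g (f x) *~ \det (act_mx to g)) ->
  gmod_iso H T.
Proof.
move=> fB bf fG; exists (pure \o f); split.
- by move=> x y; rewrite /= fB pure_zmod.
- by apply: bij_comp bf; exists unpure; [exact: pureK | exact: unpureK].
- by move=> g x; rewrite -[LHS]/(pure (f _)) fG (morphMz pure_zmod) -pure_act.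
Qed.

End Twist.

Section Main.
Variables (gT : finGroupType) (A : finType) (to : lact gT A).
Local Notation K := (tree_complex to).
Local Notation d := (#|A|%:Z - 3).
Local Notation H := (reduced_cohomology K d).
Local Notation B := (@Defs_coboundary__canonical__Algebra_ZmodClosed gT K d).
Local Notation Q := (Quotient.quot B).

(** Without letters there are no Lie monomials, and no simplex has dimension -3. *)
Lemma gmod_iso_card0 : #|A| = 0%N -> gmod_iso H (tensor (epsilon to) (Lie to)).
Proof.
move=> A0; have noA (a : A) : False by have := fintype0 a A0.
have H0 (x : H) : x = 0.
  elim/quotW: x => z; rewrite -[RHS](morph0 (@piB _ B)).
  congr (\pi_Q _); apply: val_inj; case: z => z /= /asboolP[[z0 _] _]; apply/funext => s.
  by apply/eqP/negPn/negP => /z0[_]; rewrite A0.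
have L0 (x : Lie to) : x = 0.
  apply: val_inj; case: x => x /= /asboolP; elim=> // [y [m _ _]|y z _ -> _ ->]; last by rewrite subrr.
  by elim: m => // a; case: (noA a).
apply: (@gmod_iso_tensor _ _ _ _ _ (fun _ : H => 0 : Lie to)).
- by move=> x y; rewrite subrr.
- by exists (fun _ => 0) => x; rewrite ?H0 ?L0.
- by move=> g x; symmetry; exact: L0.
Qed.

Section NonEmpty.
Variable a0 : A.
Hypothesis A1 : (1 < #|A|)%N.
Local Notation tails := (tails a0).
Local Notation to_lie := (@to_lie gT A to a0).
Local Notation pairing := (@pairing gT A to a0).

Lemma to_lie_Lie phi : (to_lie phi : free_lie_gmodule to) \in Defs.span (@multilinear gT A to).
Proof. by rewrite /to_lie big_seq rpred_sum // => v vT; rewrite rpredMz // left_normed_Lie. Qed.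

Lemma cocycle_cochain (z : cocycles K d) : cochain d (subz_val z).
Proof. by case: z => z /= /asboolP[]. Qed.

Definition lie_class (x : H) : Lie to := Subz (to_lie_Lie (subz_val (repr x))).

Lemma lie_class_pi (z : cocycles K d) : subz_val (lie_class (\pi_Q z)) = to_lie (subz_val z).
Proof.
apply/eqP; rewrite -subr_eq0 /= -to_lieB.
have /asboolP[psi _ def_psi] := @repr_pi _ B z.
by rewrite -[_ - _]/(subz_val (repr (\pi_Q z) - z)) def_psi to_lie_delta.
Qed.

Lemma subz_inj (M : zmodType) (S : zmodClosed M) : injective (@subz_val M S).
Proof. exact: val_inj. Qed.

Lemma val_subzB (M : zmodType) (S : zmodClosed M) : zmod_morphism (@subz_val M S).
Proof. by move=> x y; exact: (raddfB (val : subz S -> M)). Qed.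

Lemma lie_class_zmod : zmod_morphism lie_class.
Proof.
elim/quotW=> y; elim/quotW=> z; apply: subz_inj; rewrite val_subzB.
have -> : \pi_Q y - \pi_Q z = \pi_Q (y - z) by rewrite (@piB _ B).
by rewrite !lie_class_pi -to_lieB.
Qed.

Lemma lie_class_inj : injective lie_class.
Proof.
have ker0 x : lie_class x = 0 -> x = 0.
  elim/quotW: x => z /(congr1 (@subz_val _ _)); rewrite lie_class_pi /= => z0.
  have [v vT|psi cpsi def_z] := @pairing_eq0 gT A to a0 A1 _ (cocycle_cochain z).
    by rewrite (pairing_wcoef a0 A1 (cocycle_cochain z)) ?tail_word // z0 wcoef0.
  rewrite -[RHS](morph0 (@piB _ B)); apply/(@quot_eq _ B); rewrite subr0.
  by apply/asboolP; exists psi.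
move=> x y eq_xy; apply/eqP; rewrite -subr_eq0; apply/eqP/ker0.
by rewrite lie_class_zmod eq_xy subrr.
Qed.

Lemma Lie_coef_inj (x y : Lie to) :
  {in tails, forall v, wcoef (subz_val x) (a0 :: v) = wcoef (subz_val y) (a0 :: v)} -> x = y.
Proof.
move=> eq_xy; apply: val_inj; rewrite /= (Lie_expand a0 x) (Lie_expand a0 y).
by rewrite big_seq [RHS]big_seq; apply: eq_bigr => v vT; rewrite eq_xy.
Qed.

Lemma lie_class_surj (x : Lie to) : exists y, lie_class y = x.
Proof.
pose phi : seq (vertex K) -> int := \sum_(v <- tails)
  @comb gT A to a0 v *~ (psign (a0 :: v) (enum A) * wcoef (subz_val x) (a0 :: v)).
have cphi : phi \in @cocycle gT K d.
  rewrite /phi big_seq rpred_sum // => v vT; apply: rpredMz.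
  by apply: (cochain_cocycle a0 A1); exact: comb_cochain.
exists (\pi_Q (Subz cphi)); apply: subz_inj; rewrite lie_class_pi /=.
rewrite (morph_sum (@to_lieB gT A to a0)) [RHS](Lie_expand a0 x) big_seq [RHS]big_seq.
apply: eq_bigr => v vT; rewrite (morphMz (@to_lieB gT A to a0)) to_lie_comb //.
by rewrite -mulrzA mulrA psign_sq ?mul1r // tail_word.
Qed.

(** Elements of the Lie module are compared by the coefficients of the words that
    start with [a0]; moving the group element to the word changes its first letter. *)
Lemma lie_class_act g x :
  lie_class (Defs.gact H g x) = Defs.gact (Lie to) g (lie_class x) *~ \det (act_mx to g).
Proof.
elim/quotW: x => z; apply: Lie_coef_inj => v vT.
have -> : Defs.gact H g (\pi_Q z) = \pi_Q (Defs.gact (cocycles K d) g z).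
  by apply: etrans (quot_opE _ g z) _ => //; exact: coboundary_stable.
have actE (y : Lie to) : subz_val (Defs.gact (Lie to) g y) = flie_op to g (subz_val y) by [].
have cz := cocycle_cochain z; have pw := tail_word vT.
rewrite lie_class_pi (morphMz (@val_subzB _ _)) wcoefMz actE lie_class_pi wcoef_act.
rewrite -!(pairing_wcoef a0 A1) ?(pairing_act a0 A1) //; last exact: cochainG.
apply: uniq_perm; rewrite ?enum_uniq ?map_inj_uniq ?(uniq_word pw) //; first exact: can_inj (lopK to _).
by move=> a; rewrite mem_enum -[a](lopK to g) map_f // (perm_mem pw) mem_enum.
Qed.

Lemma gmod_iso_card_gt1 : gmod_iso H (tensor (epsilon to) (Lie to)).
Proof.
apply: gmod_iso_tensor lie_class_zmod _ lie_class_act.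
exact: inj_surj_bij lie_class_inj lie_class_surj.
Qed.

End NonEmpty.
End Main.

Theorem theorem1p3 (gT : finGroupType) (A : finType) (to : lact gT A) (n : nat)
    (cardA : #|A| = n) (n_neq1 : n <> 1%N) :
  gmod_iso (reduced_cohomology (tree_complex to) (n%:Z - 3))
           (tensor (epsilon to) (Lie to)).
Proof.
subst n; have [A0|A_gt0] := posnP #|A|; first exact: gmod_iso_card0.
have /card_gt0P[a0 _] := A_gt0.
by apply: (gmod_iso_card_gt1 to a0); rewrite ltn_neqAle eq_sym A_gt0 andbT; apply/eqP.
Qed.
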